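(* Let $r>0$ be an integer and let $X \subset \mathbb{P}^n$ be an irreducible projective variety over $\mathbb{C}$. Let $\mathrm{Stab}_r(X) := \{\tau \in \mathcal{G}_r \mid \tau \cdot X = X\}$ and $\mathrm{Fix}_r(X) := \{\tau \in \mathcal{G}_r \mid \tau|_X = \mathrm{id}_X\}$. Then the degree of the $r$-th coordinate-wise power of $X$ is $$\deg X^{\circ r} = \frac{|\mathrm{Fix}_r(X)|}{|\mathrm{Stab}_r(X)|}\; r^{\dim X}\, \deg X.$$
   Context: We work over $\mathbb{C}$. For an integer $r>0$, let $\varphi_r \colon \mathbb{P}^n \to \mathbb{P}^n$ be the morphism $[x_0:\ldots:x_n]\mapsto[x_0^r:\ldots:x_n^r]$. For a projective variety $X\subset\mathbb{P}^n$, its $r$-th coordinate-wise power is $X^{\circ r} := \varphi_r(X)$, which is a closed subvariety of $\mathbb{P}^n$, considered with its reduced structure. Let $\mathbb{Z}_r=\{\xi\in\mathbb{C}\mid \xi^r=1\}$ and let $\mathcal{G}_r := \mathbb{Z}_r^{n+1}/\{(\xi,\ldots,\xi)\mid \xi\in\mathbb{Z}_r\}$, which acts on $\mathbb{P}^n$ by rescaling the coordinates $x_0,\ldots,x_n$ by $r$-th roots of unity; in this way $\mathcal{G}_r\subset\mathrm{Aut}(\mathbb{P}^n)$. *)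

(* Defs.v *)
From HB Require Import structures.
From mathcomp Require Import mpoly.
From mathcomp Require Import all_boot all_order all_algebra generic_quotient.
From mathcomp Require Import finmap complex.
From mathcomp Require Import boolp classical_sets functions cardinality reals.

Set Implicit Arguments.
Unset Strict Implicit.
Unset Printing Implicit Defensive.

Import Order.TTheory GRing.Theory Num.Theory.
Local Open Scope ring_scope.
Local Open Scope classical_set_scope.
Local Open Scope quotient_scope.

(* The field of complex numbers is R[i] for R : realType. *)

Lemma subspace_vspace (K : fieldType) (V : vectType K) (A : set V) :
    A 0 -> (forall a u v, A u -> A v -> A (a *: u + v)) ->
  exists U : {vspace V}, forall v, v \in U <-> A v.
Proof.
move=> A0 Alin.
pose Q (U : {vspace V}) := forall v, v \in U -> A v.
pose P k := `[< exists2 U : {vspace V}, \dim U = k & Q U >].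
have P0 : exists k, P k.
  exists 0%N; apply/asboolP; exists 0%VS; first exact: dimv0.
  by move=> v /[!memv0] /eqP->.
have Pub k : P k -> (k <= \dim {:V})%N.
  by move=> /asboolP[U <- _]; apply/dimvS/subvf.
case: (ex_maxnP P0 Pub) => k /asboolP[U dU UA] kmax.
exists U => v; split=> [/UA//|Av].
have /kmax : P (\dim (<[v]> + U)).
  apply/asboolP; exists (<[v]> + U)%VS => // w.
  by move=> /memv_addP[_ /vlineP[a ->] [u uU ->]]; apply: Alin => //; apply: UA.
rewrite -dU => le; have /eqP-> : U == (<[v]> + U)%VS by rewrite eqEdim addvSr.
by rewrite memvE addvSl.
Qed.

(* Cardinality of a finite set (0 if A is infinite). *)
Definition ncard (T : choiceType) (A : set T) : nat := #|` fset_set A|.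

Section ProjectiveSpace.
Variables (R : realType) (n : nat).
Local Notation C := R[i].

Definition nzvec := {v : 'rV[C]_n.+1 | v != 0}.

Definition collinear (v w : nzvec) : bool :=
  `[< exists2 c : C, c != 0 & val v = c *: val w >].

Lemma collinear_refl : reflexive collinear.
Proof. by move=> v; apply/asboolP; exists 1; rewrite ?oner_eq0 ?scale1r. Qed.

Lemma collinear_sym : symmetric collinear.
Proof.
have H v w : collinear v w -> collinear w v.
  move=> /asboolP[c c0 e]; apply/asboolP; exists c^-1; first by rewrite invr_eq0.
  by rewrite e scalerA mulVf // scale1r.
by move=> v w; apply/idP/idP; apply: H.
Qed.

Lemma collinear_trans : transitive collinear.
Proof.
move=> w v u /asboolP[c c0 e] /asboolP[d d0 f]; apply/asboolP; exists (c * d).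
  by rewrite mulf_neq0.
by rewrite e f scalerA.
Qed.

Canonical collinear_equiv :=
  EquivRel collinear collinear_refl collinear_sym collinear_trans.

Definition projspace := {eq_quot collinear}.

Definition vanishes_at (f : {mpoly C[n.+1]}) (p : projspace) : Prop :=
  forall v : nzvec, \pi_projspace v = p -> f.@[fun i => val v 0 i] = 0.

Definition homogeneous (f : {mpoly C[n.+1]}) : Prop :=
  exists m : nat, f \is m.-homog.

Definition zariski_closed (X : set projspace) : Prop :=
  exists2 S : set {mpoly C[n.+1]},
    S `<=` homogeneous & X = [set p | forall f, S f -> vanishes_at f p].

Definition irreducible_variety (X : set projspace) : Prop :=
  [/\ zariski_closed X, X !=set0
    & forall Y Z : set projspace, zariski_closed Y -> zariski_closed Z ->
        X = Y `|` Z -> X = Y \/ X = Z].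

Definition has_chain (X : set projspace) (d : nat) : Prop :=
  exists Z : nat -> set projspace,
    (forall i, (i <= d)%N -> irreducible_variety (Z i) /\ Z i `<=` X) /\
    (forall i, (i < d)%N -> Z i `<` Z i.+1).

Definition krull_dim (X : set projspace) : nat :=
  xget 0%N [set d | has_chain X d /\ forall e, has_chain X e -> (e <= d)%N].

(* The degree m part of the homogeneous ideal of X, a subspace of the space of
   forms of degree m; xget turns the subset into an element of {vspace _}. *)
Definition ideal_part (X : set projspace) (m : nat)
    : {vspace dhomog n.+1 C m} :=
  xget 0%VS [set U : {vspace dhomog n.+1 C m} |
    forall f, f \in U <-> forall p, X p -> vanishes_at f p].

(* dim_C (C[x_0, ..., x_n] / I(X))_m *)
Definition hilbert_function (X : set projspace) (m : nat) : nat :=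
  (\dim (fullv : {vspace dhomog n.+1 C m}) - \dim (ideal_part X m))%N.

(* The polynomial agreeing with the Hilbert function in all large degrees. *)
Definition hilbert_poly (X : set projspace) : {poly rat} :=
  xget 0 [set P : {poly rat} | exists N : nat, forall m : nat, (N <= m)%N ->
    P.[m%:R] = (hilbert_function X m)%:R].

Definition degree (X : set projspace) : rat :=
  (krull_dim X)`!%:R * lead_coef (hilbert_poly X).

Lemma ideal_partP (X : set projspace) m (f : dhomog n.+1 C m) :
  f \in ideal_part X m <->
  forall p, X p -> vanishes_at (mpoly_of_dhomog f) p.
Proof.
rewrite /ideal_part; case: xgetP => [U _ -> //|] none; exfalso.
have [||U UP] := @subspace_vspace _ (dhomog n.+1 C m)
  [set g | forall p, X p -> vanishes_at (mpoly_of_dhomog g) p].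
- by move=> p _ v _; apply: meval0.
- move=> a g h gX hX p Xp v vp.
  transitivity (meval (fun i => val v 0 i)
      (a *: mpoly_of_dhomog g + mpoly_of_dhomog h)); first by [].
  by rewrite mevalD mevalZ (gX p Xp v vp) (hX p Xp v vp) mulr0 addr0.
- exact: none U UP.
Qed.

End ProjectiveSpace.

Section CoordinatewisePower.
Variables (R : realType) (n r : nat).
Local Notation C := R[i].
Local Notation Pn := (projspace R n).

Fact nzvec_pow_subproof (v : nzvec R n) :
  map_mx (fun x : C => x ^+ r) (val v) != 0.
Proof.
apply: contraNneq (valP v) => v0; apply/eqP/rowP => i.
move/rowP: v0 => /(_ i); rewrite !mxE => /eqP.
by rewrite expf_eq0 => /andP[_ /eqP].
Qed.

Definition nzvec_pow (v : nzvec R n) : nzvec R n :=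
  Sub (map_mx (fun x : C => x ^+ r) (val v)) (nzvec_pow_subproof v).

Definition phi (p : Pn) : Pn := \pi_(projspace R n) (nzvec_pow (repr p)).

Lemma phi_pi (v : nzvec R n) :
  phi (\pi_(projspace R n) v) = \pi_(projspace R n) (nzvec_pow v).
Proof.
apply/eqmodP/asboolP.
have /eqmodP/asboolP[c c0 e] := reprK (\pi_(projspace R n) v).
exists (c ^+ r); first exact: expf_neq0.
by apply/rowP => i; rewrite !mxE e !mxE exprMn.
Qed.

Definition coord_power (X : set Pn) : set Pn := phi @` X.

(* The condition xi != 0 is only relevant to r = 0, where without it
   same_mod_diag below would not be symmetric. *)
Definition unity_roots := {xi : C | (xi != 0) && (xi ^+ r == 1)}.

Definition root_tuple := {ffun 'I_n.+1 -> unity_roots}.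

Definition same_mod_diag (s t : root_tuple) : bool :=
  `[< exists xi : unity_roots, forall i, val (s i) = val xi * val (t i) >].

Lemma same_mod_diag_refl : reflexive same_mod_diag.
Proof.
move=> s; apply/asboolP.
have h : (1 != 0 :> C) && (1 ^+ r == 1 :> C) by rewrite oner_eq0 expr1n eqxx.
by exists (exist _ 1 h) => i; rewrite mul1r.
Qed.

Lemma same_mod_diag_sym : symmetric same_mod_diag.
Proof.
have H s t : same_mod_diag s t -> same_mod_diag t s.
  move=> /asboolP[[x /= hx] e]; apply/asboolP.
  have /andP[x0 /eqP x1] := hx.
  have h : (x^-1 != 0) && (x^-1 ^+ r == 1) by rewrite invr_eq0 x0 exprVn x1 invr1 eqxx.
  by exists (exist _ x^-1 h) => i /=; rewrite e mulKf.
by move=> s t; apply/idP/idP; apply: H.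
Qed.

Lemma same_mod_diag_trans : transitive same_mod_diag.
Proof.
move=> t s u /asboolP[[x hx] e] /asboolP[[y hy] f]; apply/asboolP.
have /andP[x0 /eqP x1] := hx; have /andP[y0 /eqP y1] := hy.
have h : (x * y != 0) && ((x * y) ^+ r == 1).
  by rewrite mulf_neq0 //= exprMn x1 y1 mulr1.
by exists (exist _ (x * y) h) => i; rewrite e f /= mulrA.
Qed.

Canonical same_mod_diag_equiv := EquivRel same_mod_diag
  same_mod_diag_refl same_mod_diag_sym same_mod_diag_trans.

Definition Ggroup := {eq_quot same_mod_diag}.
HB.instance Definition _ := Choice.on Ggroup.

Fact nzvec_scale_subproof (t : root_tuple) (v : nzvec R n) :
  (\row_i (val (t i) * val v 0 i) : 'rV[C]_n.+1) != 0.
Proof.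
apply: contraNneq (valP v) => v0; apply/eqP/rowP => i.
move/rowP: v0 => /(_ i); rewrite !mxE => /eqP.
by rewrite mulf_eq0 (negPf (andP (valP (t i))).1) => /eqP.
Qed.

Definition nzvec_scale (t : root_tuple) (v : nzvec R n) : nzvec R n :=
  Sub (\row_i (val (t i) * val v 0 i)) (nzvec_scale_subproof t v).

Definition gact (tau : Ggroup) (p : Pn) : Pn :=
  \pi_(projspace R n) (nzvec_scale (repr tau) (repr p)).

Lemma gact_pi (t : root_tuple) (v : nzvec R n) :
  gact (\pi_Ggroup t) (\pi_(projspace R n) v) =
  \pi_(projspace R n) (nzvec_scale t v).
Proof.
apply/eqmodP/asboolP.
have /eqmodP/asboolP[c c0 e] := reprK (\pi_(projspace R n) v).
have /eqmodP/asboolP[x f] := reprK (\pi_Ggroup t).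
exists (val x * c); first by rewrite mulf_neq0 // (andP (valP x)).1.
by apply/rowP => i; rewrite !mxE e f !mxE mulrACA.
Qed.

Definition Stab (X : set Pn) : set Ggroup := [set tau | gact tau @` X = X].

Definition Fix (X : set Pn) : set Ggroup :=
  [set tau | forall p, X p -> gact tau p = p].

Lemma finite_Ggroup : (0 < r)%N -> finite_set [set: Ggroup].
Proof.
move=> r_gt0.
have one_ur : (1 != 0 :> C) && (1 ^+ r == 1 :> C) by rewrite oner_eq0 expr1n eqxx.
pose u1 : unity_roots := Sub 1 one_ur.
have [s sE] := closed_field_poly_normal ('X^r - 1 : {poly C}).
pose h (f : {ffun 'I_n.+1 -> seq_sub s}) : Ggroup :=
  \pi_Ggroup [ffun i => insubd u1 (ssval (f i))].
have hs (x : unity_roots) : val x \in s.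
  have : root ('X^r - 1 : {poly C}) (val x).
    by rewrite rootE !hornerE ?hornerXn (eqP (andP (valP x)).2) subrr.
  rewrite sE rootZ ?root_prod_XsubC // lead_coef_eq0 -size_poly_eq0.
  by rewrite size_XnsubC.
apply: (@sub_finite_set _ _ (h @` [set: {ffun 'I_n.+1 -> seq_sub s}])); last first.
  exact/finite_image/finite_finset.
move=> tau _; exists [ffun i => SeqSub (hs (repr tau i))] => //.
rewrite /h -[RHS]reprK; congr (\pi_Ggroup _); apply/ffunP => i.
by rewrite !ffunE /= valKd.
Qed.

End CoordinatewisePower.

Arguments Stab {R n} r X.
Arguments Fix {R n} r X.
Arguments coord_power {R n} r X.
Arguments phi {R n} r p.

(* Main.v *)
(* Let d = dim X, let Y be the union of the translates of X by the group Z_r^{n+1},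
   and let N be their number.  Distinct translates are irreducible with the same
   Hilbert polynomial, so that the Hilbert polynomial of Y has N times the leading
   coefficient of the one of X.  As the ideal of Y is stable under the group, it
   is spanned by elements x^a h(x^r) with 0 <= a_i < r, and such an element is in
   it iff h vanishes on the power W of X or some x_i with a_i > 0 vanishes on X.
   Hence the standard monomials of Y are the x^(a + r v) with v standard for W and
   a supported on the set of k coordinates that are not zero on X, and counting
   those of degree at most r m gives r^k lc(W) = r^(d+1) N lc(X), where lc is the
   leading coefficient of the Hilbert polynomial.  Now N = r^n / |Stab| and
   |Fix| = r^(n+1-k).  Hilbert polynomials exist by Dickson's lemma, and the
   degree of that of an irreducible variety is its Krull dimension by the
   Nullstellensatz. *)

Require Import Defs.
From HB Require Import structures.
From mathcomp Require Import mpoly.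
From mathcomp Require Import all_boot all_order all_algebra all_field.
From mathcomp Require Import cyclic finmap complex.
From mathcomp Require Import boolp classical_sets cardinality reals.
From mathcomp Require Import ring lra zify.

Set Implicit Arguments.
Unset Strict Implicit.
Unset Printing Implicit Defensive.

Import Order.TTheory GRing.Theory Num.Theory.
Local Open Scope ring_scope.

(** * Eventually polynomial functions *)

(** The leading coefficients of Hilbert polynomials are compared only through inequalities between
    counting functions that hold for large arguments; bounded shifts of the argument do not affect a
    leading term, so all error terms are expressed as such shifts. This is how distinct translates
    are treated as if they were disjoint, and how the remainder a in x^(a + r v) is neglected. The
    union of translates replaces X because the ideal of X need not be stable under the group, hence
    need not split into components x^a h(x^r). Standard monomials are counted up to a degree rather
    than in one degree: for a fixed total degree, the degree of v depends on a. Cumulation raises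
    the degree of the polynomial from d to d + 1, whence r^(d+1). The surplus factor r is the order
    of the diagonal: orbits are counted with tuples in Z_r^(n+1), while [Stab] lives in the
    quotient. The Krull dimension of the power is accessible only once the power is known to be
    closed and irreducible; both are obtained from its ideal, the first by the same components x^a
    h(x^r). *)

Definition eventually_poly (f : nat -> nat) (P : {poly rat}) : Prop :=
  exists N : nat, forall m : nat, (N <= m)%N -> P.[m%:R] = (f m)%:R.

Lemma coef_neq0_size (R : nzRingType) (p : {poly R}) i : p`_i != 0 -> (i < size p)%N.
Proof. by apply: contraNltn => /leq_sizeP->. Qed.

(** Horner induction: once [P] exceeds |B - c| at m >= 1, the product m P(m) does so too, hence m
    P(m) + c exceeds B. The linear case uses the Archimedean bound. *)
Lemma poly_ev_gt (P : {poly rat}) (B : rat) :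
    (1 < size P)%N -> 0 < lead_coef P ->
  exists N : nat, forall m : nat, (N <= m)%N -> B < P.[m%:R].
Proof.
elim/poly_ind: P B => [|P c IH] B; first by rewrite size_poly0.
have [->|P0] := eqVneq P 0.
  by rewrite mul0r add0r => /leq_trans/(_ (size_polyC_leq1 c)).
move=> _; rewrite lead_coefDl; last first.
  by rewrite size_mulX // ltnS (leq_trans (size_polyC_leq1 c)) // size_poly_gt0.
rewrite lead_coefMX => lc0.
have [sP|sP] := leqP (size P) 1.
  have PE : P = (lead_coef P)%:P by rewrite {1}(size1_polyC sP) lead_coefE; case: (size P) sP => [|[]].
  exists (Num.bound ((B - c) / lead_coef P)) => m Nm.
  rewrite hornerMXaddC {1}PE hornerC -ltrBlDr mulrC -ltr_pdivrMr //.
  apply: (le_lt_trans (ler_norm _)); apply: lt_le_trans (archi_boundP (normr_ge0 _)) _.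
  rewrite ler_nat; apply: leq_trans Nm; rewrite /Num.bound.
  by rewrite normr_id.
have [N HN] := IH `|B - c| sP lc0.
exists N.+1 => -[//|m] Nm.
rewrite hornerMXaddC -ltrBlDr; apply: (le_lt_trans (ler_norm _)).
apply: (lt_le_trans (HN _ (ltnW Nm))).
rewrite ler_peMr //; last by rewrite ler1n.
exact: ltW (le_lt_trans (normr_ge0 _) (HN _ (ltnW Nm))).
Qed.

Lemma poly_ev_pos (P : {poly rat}) : 0 < lead_coef P ->
  exists N : nat, forall m : nat, (N <= m)%N -> 0 < P.[m%:R].
Proof.
move=> lc0; have [sP|] := leqP (size P) 1; last by move/poly_ev_gt; apply.
exists 0%N => m _; move: lc0.
by rewrite (size1_polyC sP) lead_coefC hornerC.
Qed.

Lemma poly_ev_ge0 (P : {poly rat}) :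
    (exists N : nat, forall m : nat, (N <= m)%N -> 0 <= P.[m%:R]) ->
  0 <= lead_coef P.
Proof.
move=> [N HN]; rewrite leNgt; apply/negP => lt0.
have [|M HM] := @poly_ev_pos (- P); first by rewrite lead_coefN oppr_gt0.
have := HM _ (leq_maxr N M); rewrite hornerN oppr_gt0 ltNge.
by rewrite HN // leq_maxl.
Qed.

(** The leading coefficient of Q - P is nonnegative. If P had the larger size, it would be that of
    -P, which is negative. *)
Lemma poly_ev_le (P Q : {poly rat}) : 0 <= lead_coef P ->
    (exists N : nat, forall m : nat, (N <= m)%N -> P.[m%:R] <= Q.[m%:R]) ->
  (size P <= size Q)%N /\ (size P = size Q -> lead_coef P <= lead_coef Q).
Proof.
move=> P0 [N HN]; have le0 : 0 <= lead_coef (Q - P).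
  by apply: poly_ev_ge0; exists N => m /HN; rewrite hornerD hornerN subr_ge0.
split; last first.
  move=> sPQ; have [e|ne] := eqVneq (lead_coef P) (lead_coef Q); first by rewrite e.
  move: le0; rewrite !lead_coefE in ne *.
  have -> : size (Q - P) = size P.
    apply/eqP; rewrite eqn_leq; apply/andP; split.
      by rewrite (leq_trans (size_polyD _ _)) // size_polyN sPQ maxnn.
    rewrite -[X in (X <= _)%N]prednK; last first.
      rewrite lt0n size_poly_eq0; apply: contraNneq ne => p0.
      move/eqP: sPQ; rewrite p0 size_poly0 eq_sym size_poly_eq0 => /eqP->.
      by rewrite size_poly0.
    by apply: coef_neq0_size; rewrite coefB subr_eq0 eq_sym; move: ne; rewrite sPQ.
  by rewrite coefB subr_ge0 sPQ.
rewrite leqNgt; apply/negP => lt.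
move: le0; rewrite lead_coefDr ?size_polyN // lead_coefN oppr_ge0 => le0.
have /eqP := le_anti (introT andP (conj le0 P0)).
by rewrite lead_coef_eq0 => /eqP P00; rewrite P00 size_poly0 in lt.
Qed.

Lemma eventually_poly_le f g P Q : eventually_poly f P -> eventually_poly g Q ->
    (exists N : nat, forall m : nat, (N <= m)%N -> (f m <= g m)%N) ->
  (size P <= size Q)%N /\ (size P = size Q -> lead_coef P <= lead_coef Q).
Proof.
move=> [N HN] [M HM] [K HK]; apply: poly_ev_le.
  by apply: poly_ev_ge0; exists N => m /HN ->.
exists (maxn N (maxn M K)) => m; rewrite !geq_max => /and3P[Nm Mm Km].
by rewrite HN // HM // ler_nat HK.
Qed.

Lemma eventually_poly_lc_ge0 f P : eventually_poly f P -> 0 <= lead_coef P.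
Proof. by move=> [N HN]; apply: poly_ev_ge0; exists N => m /HN ->. Qed.

Lemma eventually_poly_uniq f P Q :
  eventually_poly f P -> eventually_poly f Q -> P = Q.
Proof.
move=> [N HN] [M HM]; apply/eqP; rewrite -subr_eq0 -lead_coef_eq0 eq_le.
apply/andP; split.
  rewrite -oppr_ge0 -lead_coefN; apply: poly_ev_ge0; exists (maxn N M) => m.
  by rewrite geq_max hornerN hornerD hornerN => /andP[/HN-> /HM->]; rewrite subrr oppr0.
apply: poly_ev_ge0; exists (maxn N M) => m.
by rewrite geq_max hornerD hornerN => /andP[/HN-> /HM->]; rewrite subrr.
Qed.

Lemma eventually_polyD f g P Q : eventually_poly f P -> eventually_poly g Q ->
  eventually_poly (fun m => f m + g m)%N (P + Q).
Proof.
move=> [N HN] [M HM]; exists (maxn N M) => m.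
by rewrite geq_max hornerD natrD => /andP[/HN-> /HM->].
Qed.

Lemma eventually_poly0 : eventually_poly (fun=> 0%N) 0.
Proof. by exists 0%N => m _; rewrite horner0. Qed.

Lemma eventually_poly_ext f g P : (exists N, forall m, (N <= m)%N -> f m = g m) ->
  eventually_poly f P -> eventually_poly g P.
Proof.
move=> [N HN] [M HM]; exists (maxn N M) => m.
by rewrite geq_max => /andP[/HN<- /HM->].
Qed.

Definition shift_poly (c : rat) (P : {poly rat}) : {poly rat} := P \Po ('X + c%:P).

Lemma horner_shift c P x : (shift_poly c P).[x] = P.[x + c].
Proof. by rewrite horner_comp !hornerE. Qed.

Lemma size_shift c P : size (shift_poly c P) = size P.
Proof. by rewrite size_comp_poly2 // -[c]opprK polyCN size_XsubC. Qed.

Lemma lead_coef_shift c P : lead_coef (shift_poly c P) = lead_coef P.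
Proof.
by rewrite lead_coef_comp -[c]opprK polyCN ?size_XsubC // lead_coefXsubC expr1n mulr1.
Qed.

Lemma eventually_poly_shift f P d : eventually_poly f P ->
  eventually_poly (fun m => f (m - d)%N) (shift_poly (- d%:R) P).
Proof.
move=> [N HN]; exists (N + d)%N => m Nm.
have dm : (d <= m)%N by rewrite (leq_trans _ Nm) // leq_addl.
by rewrite horner_shift -natrB // HN // leq_subRL // addnC.
Qed.

Lemma eventually_poly_shiftD f P d : eventually_poly f P ->
  eventually_poly (fun m => f (m + d)%N) (shift_poly d%:R P).
Proof.
move=> [N HN]; exists N => m Nm.
by rewrite horner_shift -natrD HN // (leq_trans Nm) // leq_addr.
Qed.

Lemma eventually_poly_sum (I : Type) (s : seq I) (F : I -> nat -> nat) :
    (forall i, exists P, eventually_poly (F i) P) ->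
  exists P, eventually_poly (fun m => \sum_(i <- s) F i m)%N P.
Proof.
move=> FP; elim: s => [|i s [P HP]].
  by exists 0; apply: eventually_poly_ext eventually_poly0; exists 0%N => m _; rewrite big_nil.
have [Q HQ] := FP i; exists (Q + P).
by apply: eventually_poly_ext (eventually_polyD HQ HP); exists 0%N => m _; rewrite big_cons.
Qed.

Definition diff_poly (c : rat) (P : {poly rat}) : {poly rat} := shift_poly c P - P.

(** The claim concerns the coefficient at [d], zero or not, so that the induction on P = Q X + a
    need not follow the exact degree. *)
Lemma diff_poly_coef c d (P : {poly rat}) : (size P <= d.+1)%N ->
  (size (diff_poly c P) <= d)%N /\
  (diff_poly c P)`_d.-1 = d%:R * c * P`_d.
Proof.
elim: d P => [|d IH] P sP.
  have -> : diff_poly c P = 0.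
    by rewrite (size1_polyC sP) /diff_poly /shift_poly comp_polyC subrr.
  by rewrite size_poly0 coef0 !mul0r.
have [Q [a PE]] : exists Q a, P = Q * 'X + a%:P.
  by elim/poly_ind: P {sP} => [|Q a _]; [exists 0, 0; rewrite mul0r addr0|exists Q, a].
have sQ : (size Q <= d.+1)%N.
  apply/leq_sizeP => j dj; have /leq_sizeP/(_ j.+1) := sP.
  by rewrite PE coefD coefMX coefC /= addr0; apply.
have [sD cD] := IH _ sQ.
have -> : diff_poly c P = diff_poly c Q * ('X + c%:P) + c *: Q.
  rewrite /diff_poly /shift_poly PE comp_polyD comp_polyM comp_polyX comp_polyC -mul_polyC.
  by ring.
split.
  rewrite (leq_trans (size_polyD _ _)) // geq_max; apply/andP; split; last first.
    exact: leq_trans (size_scale_leq _ _) _.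
  rewrite (leq_trans (size_polyMleq _ _)) // -[c]opprK polyCN size_XsubC addn2 /=.
  by rewrite opprK.
rewrite /= PE !coefD coefMX coefC /= addr0 mulrDr coefD coefMX coefMC coefZ.
have /leq_sizeP/(_ d (leqnn _)) -> := sD.
rewrite mul0r addr0.
case: d {IH sP sQ} sD cD => [|d] sD cD /=; first by rewrite add0r mul1r.
by rewrite cD -[in RHS]natr1 /=; ring.
Qed.

Lemma size_lc_diff_poly c (P : {poly rat}) d : c != 0 -> size P = d.+2 ->
  size (diff_poly c P) = d.+1 /\
  lead_coef (diff_poly c P) = d.+1%:R * c * lead_coef P.
Proof.
move=> c0 sP; have [|sD cD] := @diff_poly_coef c d.+1 P; first by rewrite sP.
have lcE : lead_coef P = P`_d.+1 by rewrite lead_coefE sP.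
have ne0 : (diff_poly c P)`_d != 0.
  by rewrite cD !mulf_neq0 ?pnatr_eq0 // -lcE lead_coef_eq0 -size_poly_eq0 sP.
have sE : size (diff_poly c P) = d.+1.
  by apply/eqP; rewrite eqn_leq sD; apply: coef_neq0_size.
by split => //; rewrite lcE -cD lead_coefE sE.
Qed.

Lemma size_diff_poly_lt c (P : {poly rat}) : P != 0 ->
  (size (diff_poly c P) < size P)%N.
Proof.
rewrite -size_poly_gt0; case sP : (size P) => [//|d] _.
by have [|] := @diff_poly_coef c d P; rewrite ?sP.
Qed.

(** A discrete antiderivative: a multiple of X^(d+1) produces the top term of Q, and the rest has
    smaller size. *)
Lemma diff_poly_surj (Q : {poly rat}) : exists S, diff_poly 1 S = Q.
Proof.
have [d] := ubnP (size Q); elim: d Q => // d IH Q.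
rewrite ltnS leq_eqVlt => /orP[/eqP sQ|]; last exact: IH.
case: d IH sQ => [|d] IH sQ.
  exists 0; move/eqP: sQ; rewrite size_poly_eq0 => /eqP->.
  by rewrite /diff_poly /shift_poly comp_poly0 subrr.
pose S0 : {poly rat} := (lead_coef Q / d.+1%:R) *: 'X^(d.+1).
have [|sD cD] := @diff_poly_coef 1 d.+1 S0.
  by rewrite (leq_trans (size_scale_leq _ _)) // size_polyXn.
have [|S SE] := IH (Q - diff_poly 1 S0).
  rewrite ltnS; apply/leq_sizeP => j.
  rewrite leq_eqVlt => /orP[/eqP<-|dj].
    rewrite coefB cD coefZ coefXn eqxx mulr1 mulr1 mulrC divfK ?pnatr_eq0 //.
    by rewrite lead_coefE sQ subrr.
  rewrite coefB; have /leq_sizeP -> // := sD; rewrite subr0.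
  by have /leq_sizeP -> // : (size Q <= d.+1)%N by rewrite sQ.
exists (S0 + S); rewrite -[RHS](subrK (diff_poly 1 S0)) -SE.
rewrite /diff_poly /shift_poly comp_polyD; ring.
Qed.

(** The cumulated sum grows by f (m + 1) from m to m + 1, so it is an antiderivative of P shifted by
    1; integration divides the leading coefficient by the new degree, which is [size P]. *)
Lemma eventually_poly_cumul f P : eventually_poly f P -> P != 0 ->
  exists S, [/\ eventually_poly (fun m => \sum_(j < m.+1) f j)%N S,
    size S = (size P).+1 & (size P)%:R * lead_coef S = lead_coef P].
Proof.
move=> [N HN] P0; have [S0 S0E] := diff_poly_surj (shift_poly 1 P).
(* The constant of integration, which absorbs the values of [f] below [N] that are not
   polynomial. *)
pose a := (\sum_(j < N.+1) f j)%:R - S0.[N%:R].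
have sS0 : size S0 = (size P).+1.
  have sd : size (diff_poly 1 S0) = size P by rewrite S0E size_shift.
  have : (0 < size P)%N by rewrite size_poly_gt0.
  case e : (size S0) sd => [|[|d]].
  - by move/eqP: e; rewrite size_poly_eq0 => /eqP ->; rewrite /diff_poly /shift_poly comp_poly0 subrr size_poly0 => <-.
  - have /size1_polyC -> : (size S0 <= 1)%N by rewrite e.
    by rewrite /diff_poly /shift_poly comp_polyC subrr size_poly0 => <-.
  - by have [-> _] := size_lc_diff_poly (oner_neq0 _) e => <-.
have sP : (0 < size P)%N by rewrite size_poly_gt0.
have sa : (size a%:P < size S0)%N.
  by rewrite sS0 ltnS (leq_trans (size_polyC_leq1 _)).
exists (S0 + a%:P); split; first last.
- rewrite lead_coefDl // -(lead_coef_shift 1 P) -S0E.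
  case: (size P) sP sS0 => // d _ sS0.
  have [_ ->] := size_lc_diff_poly (oner_neq0 _) sS0.
  by rewrite mulr1.
- by rewrite size_polyDl.
exists N => m; elim: m => [|m IH] Nm.
  have N0 : N = 0%N by case: N Nm {a sa HN}.
  by rewrite hornerD hornerC /a N0; ring.
move: Nm; rewrite leq_eqVlt => /orP[/eqP <-|Nm].
  by rewrite hornerD hornerC /a; ring.
rewrite big_ord_recr /= natrD -IH // -HN; last exact: leqW.
have := congr1 (fun p : {poly rat} => p.[m%:R]) S0E.
rewrite /= hornerD hornerN !horner_shift natr1 => <-.
rewrite !hornerD !hornerC; ring.
Qed.

Lemma eventually_poly_cumul_ex f P : eventually_poly f P ->
  exists S, eventually_poly (fun m => \sum_(j < m.+1) f j)%N S.
Proof.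
have [-> [N HN]|P0 HP] := eqVneq P 0; last first.
  by have [S [HS _ _]] := eventually_poly_cumul HP P0; exists S.
exists ((\sum_(j < N) f j)%:R)%:P; exists N => m Nm; rewrite hornerC.
congr (_%:R); rewrite -(big_mkord xpredT) -(big_mkord xpredT f).
rewrite [RHS](big_cat_nat (n := N)) //=; last exact: leqW.
rewrite [X in (_ = _ + X)%N]big_nat_cond [X in (_ = _ + X)%N]big1 ?addn0 //.
move=> i /andP[/andP[Ni _] _]; apply/eqP.
by rewrite -(eqr_nat rat) -HN // horner0.
Qed.

(** * Up-closed sets of monomials *)

Section Monomials.
Local Open Scope nat_scope.

Lemma strictly_increasing_nat (g : nat -> nat) :
  (forall i, g i < g i.+1) -> {homo g : i j / i < j}.
Proof. by move=> gS; apply: homo_ltn => //; exact: ltn_trans. Qed.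

(** Each index is chosen where [f] is minimal on the tail that starts just after the previous
    one. *)
Lemma nat_monotone_subseq (f : nat -> nat) : exists g : nat -> nat,
  {homo g : i j / i < j} /\ {homo f \o g : i j / i <= j}.
Proof.
have am N : exists i, N <= i /\ forall j, N <= j -> f i <= f j.
  have ex : exists v, `[< exists2 i, N <= i & f i = v >] by exists (f N); apply/asboolP; exists N.
  case: (ex_minnP ex) => v /asboolP[i Ni <-] vmin; exists i; split => // j Nj.
  by apply: vmin; apply/asboolP; exists j.
have [a aP] := choice am.
pose g := fix g i := if i is i'.+1 then a (g i').+1 else a 0.
have gS i : g i < g i.+1 by rewrite /=; case: (aP (g i).+1).
exists g; split; first exact: strictly_increasing_nat.
apply: homo_leq => //=; first exact: leq_trans.
move=> i; have [N Ng gmin] : exists2 N, N <= g i & forall j, N <= j -> f (g i) <= f j.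
  case: i => [|i]; last by have [? ?] := aP (g i).+1; exists (g i).+1.
  by have [? ?] := aP 0; exists 0.
by apply: gmin; apply: leq_trans Ng _; exact: ltnW (gS i).
Qed.

(** Dickson's lemma for sequences: one coordinate after another is made monotone by passing to a
    subsequence. *)
Lemma dickson_subseq k (f : nat -> seq nat) : (forall i, size (f i) = k) ->
  exists g : nat -> nat, {homo g : i j / i < j} /\
    forall i j, i <= j -> all2 leq (f (g i)) (f (g j)).
Proof.
elim: k f => [|k IH] f sf.
  by exists id; split => // i j _; rewrite !(size0nil (sf _)).
have [g [g_inc g_mono]] := nat_monotone_subseq (fun i => head 0 (f i)).
have [|h [h_inc h_mono]] := IH (fun i => behead (f (g i))).
  by move=> i; rewrite size_behead sf.
exists (g \o h); split; first by move=> i j /h_inc/g_inc.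
move=> i j ij /=; have := h_mono i j ij.
have : h i <= h j by move: ij; rewrite leq_eqVlt => /orP[/eqP->//|/h_inc/ltnW].
move=> /g_mono /=.
by have := sf (g (h i)); have := sf (g (h j)); case: (f _) => // x s _; case: (f _) => //= y t _ -> ->.
Qed.

Definition up_closed k (U : pred (seq nat)) : Prop :=
  forall s t, size s = k -> size t = k -> all2 leq s t -> U s -> U t.

(** The ascending chain condition for monomial ideals. Otherwise new monomials keep entering, and by
    Dickson one of them is a multiple of a monomial that entered at an earlier stage, so it was not
    new. *)
Lemma up_closed_stable k (U : nat -> pred (seq nat)) :
    (forall i, up_closed k (U i)) ->
    (forall i s, size s = k -> U i s -> U i.+1 s) ->
  exists K, forall j s, K <= j -> size s = k -> U j s -> U K s.
Proof.
move=> Uup Ui; apply: contrapT => /forallNP nst.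
have mono i j s : i <= j -> size s = k -> U i s -> U j s.
  move=> + sk Uis; elim: j => [|j IHj]; first by rewrite leqn0 => /eqP <-.
  by rewrite leq_eqVlt => /orP[/eqP<-//|/IHj]; exact: Ui.
have ex K : exists js : nat * seq nat, [/\ K <= js.1, size js.2 = k, U js.1 js.2 & ~~ U K js.2].
  have /existsNP[j /existsNP[s]] := nst K.
  move=> /not_implyP[Kj] /not_implyP[sk] /not_implyP[Ujs /negP nUK].
  by exists (j, s).
have [c cP] := choice ex.
pose K := fix K i := if i is i'.+1 then (c (K i')).1 else 0.
have Kle i j : i <= j -> K i <= K j.
  move=> ij; elim: j ij => [|j IHj]; first by rewrite leqn0 => /eqP->.
  rewrite leq_eqVlt => /orP[/eqP->//|/IHj /leq_trans]; apply.
  by rewrite /=; case: (cP (K j)).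
have [|g [g_inc g_mono]] := @dickson_subseq k (fun i => (c (K i)).2).
  by move=> i; case: (cP (K i)).
have [_ s0 Us0 _] := cP (K (g 0)); have [_ s1 _ /negP nU1] := cP (K (g 1)).
apply: nU1; apply: (mono (K (g 0).+1)); [exact/Kle/g_inc|by []|].
by apply: (Uup _ _ _ s0) => //; apply: g_mono.
Qed.

Fixpoint monos (k m : nat) : seq (seq nat) :=
  if k is k'.+1 then
    flatten [seq [seq j :: s | s <- monos k' (m - j)] | j <- iota 0 m.+1]
  else nseq (m == 0) [::].

Lemma monosS k m : monos k.+1 m =
  flatten [seq [seq j :: s | s <- monos k (m - j)] | j <- iota 0 m.+1].
Proof. by []. Qed.

Lemma mem_monos k m s : (s \in monos k m) = (size s == k) && (sumn s == m).
Proof.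
elim: k m s => [|k IH] m s.
  by case: s => [|x s]; case: m.
rewrite monosS.
apply/flattenP/idP => [[_ /mapP[j + ->] /mapP[t]]|].
  rewrite mem_iota add0n ltnS IH => /= jm /andP[/eqP st /eqP sm] ->.
  by rewrite /= st sm eqxx /= subnKC.
case: s => // j s; rewrite [size _]/= [sumn _]/= eqSS => /andP[/eqP ss /eqP sm].
exists [seq j :: s | s <- monos k (m - j)].
  by apply: (map_f (fun i => [seq i :: s0 | s0 <- monos k (m - i)])); rewrite mem_iota add0n ltnS -sm leq_addr.
by apply/mapP; exists s => //; rewrite IH ss -sm addKn !eqxx.
Qed.

Lemma monos_uniq k m : uniq (monos k m).
Proof.
elim: k m => [|k IH] m; first by case: m.
rewrite monosS.
have : uniq (iota 0 m.+1) by rewrite iota_uniq.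
elim: (iota 0 m.+1) => //= j s IHs /andP[js us].
rewrite cat_uniq map_inj_uniq ?IH ?IHs //= ?andbT; last by move=> ? ? [].
apply/hasPn => t /flattenP[_ /mapP[i si ->]] /mapP[u _ ->].
by apply/mapP => -[v _ [ij _]]; rewrite -ij si in js.
Qed.

Lemma count_monosS k m (P : pred (seq nat)) :
  count P (monos k.+1 m) =
  \sum_(j < m.+1) count (fun s => P (nat_of_ord j :: s)) (monos k (m - j)).
Proof.
rewrite monosS count_flatten sumnE !big_map -(big_mkord xpredT (fun j => count (fun s => P (j :: s)) (monos k (m - j)))).
by rewrite /index_iota subn0; apply: eq_bigr => j _; rewrite count_map.
Qed.

(** The slices by the first exponent increase and are constant from some [K] on. Those below [K]
    contribute finitely many shifted polynomials, the others a cumulated sum of a single counting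
    function. *)
Lemma up_closed_count_poly k (U : pred (seq nat)) : up_closed k U ->
  exists P, eventually_poly (fun m => count (predC U) (monos k m)) P.
Proof.
elim: k U => [|k IH] U Uup.
  exists 0%R; exists 1 => -[//|m] _; by rewrite /= horner0.
pose V j := fun s => U (j :: s).
have Vup j : up_closed k (V j).
  by move=> s t ss st le; apply: Uup => /=; rewrite ?ss ?st ?leqnn.
have [|K VK] := up_closed_stable Vup.
  move=> i s ss; apply: Uup => /=; rewrite ?ss // leqnSn /=.
  by elim: s {ss} => //= x s ->; rewrite leqnn.
pose h j m := count (predC (V j)) (monos k m).
have hP j : exists P, eventually_poly (h j) P by exact: IH.
have [P1 HP1] : exists P, eventually_poly (fun m => \sum_(j <- iota 0 K) h j (m - j)) P.
  apply: eventually_poly_sum => j; have [P HP] := hP j.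
  by exists (shift_poly (- j%:R)%R P); exact: eventually_poly_shift.
have [PK HPK] := hP K; have [S HS] := eventually_poly_cumul_ex HPK.
exists (P1 + shift_poly (- K%:R) S)%R.
apply: eventually_poly_ext (eventually_polyD HP1 (eventually_poly_shift K HS)).
exists K => m Km; rewrite count_monosS -(big_mkord xpredT (fun j => h j (m - j))).
rewrite [RHS](big_cat_nat (n := K)) //=; last exact: leqW.
congr (_ + _); first by rewrite /index_iota subn0.
rewrite -[X in \sum_(X <= _ < _) _]add0n big_addn subSn // big_mkord.
(* Reversal matches the degree left to the other exponents with the summation index of [HS]. *)
rewrite (reindex_inj rev_ord_inj) /=; apply: eq_bigr => i _.
rewrite /h subSS; have im : i <= m - K by rewrite -ltnS.
have -> : m - K - i = m - (i + K) by lia.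
apply: eq_in_count => s; rewrite mem_monos => /andP[/eqP ss _] /=.
congr (~~ _); apply/idP/idP; last by apply: VK => //; rewrite leq_addl.
elim: (nat_of_ord i) => [|d IHd]; first by rewrite add0n.
move=> /IHd; apply: Uup => /=; rewrite ?ss // leqnSn /=.
by elim: s {ss IHd} => //= x s ->; rewrite leqnn.
Qed.

End Monomials.

(** * Graded ideals and their Hilbert functions *)

Lemma sub_in_count (T : eqType) (a b : pred T) (s : seq T) :
  (forall x, x \in s -> a x -> b x) -> (count a s <= count b s)%N.
Proof.
elim: s => //= x s IH ab; rewrite leq_add ?IH //.
  by case: (a x) (ab x) => // /(_ (mem_head _ _) isT) ->.
by move=> y ys; apply: ab; rewrite inE ys orbT.
Qed.

Section GradedIdeals.
Variables (F : fieldType) (n : nat).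
Local Notation S := {mpoly F[n.+1]}.
Local Notation dh m := (dhomog n.+1 F m).

(* A graded ideal, presented as the family of its homogeneous parts. *)
Definition gideal (J : nat -> set S) : Prop :=
  [/\ forall m f, J m f -> f \is m.-homog,
      forall m, J m 0,
      forall m a f g, J m f -> J m g -> J m (a *: f + g)
    & forall m k f g, J m f -> g \is k.-homog -> J (k + m)%N (g * f)].

Definition gsub (J K : nat -> set S) : Prop := forall m f, J m f -> K m f.

Definition gpart (J : nat -> set S) (m : nat) : {vspace dh m} :=
  xget 0%VS [set U : {vspace dh m} | forall f, f \in U <-> J m (mpoly_of_dhomog f)].

Definition hf (J : nat -> set S) (m : nat) : nat :=
  (\dim (fullv : {vspace dh m}) - \dim (gpart J m))%N.

Lemma gpartP J m (f : dh m) : gideal J -> f \in gpart J m <-> J m (mpoly_of_dhomog f).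
Proof.
move=> [_ J0 JD _]; rewrite /gpart; case: xgetP => [U _ -> //|none]; exfalso.
have [||U UP] := @subspace_vspace _ (dh m) (fun g => J m (mpoly_of_dhomog g)).
- exact: J0.
- by move=> a g h /(JD _ a); apply.
- exact: none U UP.
Qed.

Lemma gpart_eq J m (U : {vspace dh m}) :
  (forall f : dh m, f \in U <-> J m (mpoly_of_dhomog f)) -> gpart J m = U.
Proof.
move=> UP; rewrite /gpart; case: xgetP => [V _ VP|/(_ _ UP)//].
by apply/vspaceP => f; apply/idP/idP => [/VP/UP|/UP/VP].
Qed.

Lemma gideal_homog J m f : gideal J -> J m f -> f \is m.-homog.
Proof. by case=> H _ _ _; apply: H. Qed.

Lemma gideal0 J m : gideal J -> J m 0.
Proof. by case. Qed.

Lemma gidealD J m f g : gideal J -> J m f -> J m g -> J m (f + g).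
Proof. by case=> _ _ JD _ Jf Jg; rewrite -[f]scale1r; apply: JD. Qed.

Lemma gidealZ J m a f : gideal J -> J m f -> J m (a *: f).
Proof. by case=> _ J0 JD _ Jf; rewrite -[_ *: _]addr0; apply: JD. Qed.

Lemma gidealN J m f : gideal J -> J m f -> J m (- f).
Proof. by move=> gJ Jf; rewrite -scaleN1r; apply: gidealZ. Qed.

Lemma gidealB J m f g : gideal J -> J m f -> J m g -> J m (f - g).
Proof. by move=> gJ Jf Jg; apply: gidealD => //; apply: gidealN. Qed.

Lemma gidealMl J m k f g : gideal J -> g \is k.-homog -> J m f -> J (k + m)%N (g * f).
Proof. by case=> _ _ _ JM gk Jf; apply: JM. Qed.

Lemma gidealMr J m k f g : gideal J -> g \is k.-homog -> J m f -> J (m + k)%N (f * g).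
Proof. by move=> gJ gk Jf; rewrite mulrC addnC; apply: gidealMl. Qed.

Lemma gideal_sum J m (I : Type) (s : seq I) (P : pred I) (f : I -> S) :
  gideal J -> (forall i, P i -> J m (f i)) -> J m (\sum_(i <- s | P i) f i).
Proof.
move=> gJ Jf; elim/big_ind: _ => //; first exact: gideal0.
by move=> *; apply: gidealD.
Qed.

Lemma dim_gpart_le J m : (\dim (gpart J m) <= \dim (fullv : {vspace dh m}))%N.
Proof. exact/dimvS/subvf. Qed.

Lemma gpartS J K m : gideal J -> gideal K -> gsub J K ->
  (gpart J m <= gpart K m)%VS.
Proof. by move=> gJ gK JK; apply/subvP => f /(gpartP _ gJ)/JK/(gpartP _ gK). Qed.

Lemma hfS J K m : gideal J -> gideal K -> gsub J K -> (hf K m <= hf J m)%N.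
Proof. by move=> gJ gK JK; apply/leq_sub2l/dimvS/gpartS. Qed.

Lemma gsub_hf_eq J K : gideal J -> gideal K -> gsub J K ->
  (forall m, (hf J m <= hf K m)%N) -> gsub K J.
Proof.
move=> gJ gK JK hJK m f Kf.
have /eqP e : gpart J m == gpart K m.
  rewrite eqEdim gpartS //=; have := hJK m; rewrite /hf.
  have := dim_gpart_le J m; have := dim_gpart_le K m; lia.
have fm := gideal_homog gK Kf.
have /(gpartP _ gJ) // : DHomog fm \in gpart J m.
by rewrite e; apply/gpartP.
Qed.

Definition gcolon (J : nat -> set S) e (a : S) : nat -> set S :=
  fun m f => f \is m.-homog /\ J (e + m)%N (a * f).

Lemma gideal_colon J e a : gideal J -> gideal (gcolon J e a).
Proof.
move=> gJ; split.
- by move=> m f [].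
- by move=> m; split; [exact: dhomog0|rewrite mulr0; exact: gideal0].
- move=> m c f g [fm Jf] [gm Jg]; split; first by rewrite rpredD ?rpredZ.
  by rewrite mulrDr -scalerAr; apply: gidealD => //; apply: gidealZ.
- move=> m k f g [fm Jf] gk; split; first exact: dhomogM.
  by rewrite mulrCA addnCA; apply: gidealMl.
Qed.

Lemma gsub_colon J e a : gideal J -> a \is e.-homog -> gsub J (gcolon J e a).
Proof.
by move=> gJ ae m f Jf; split; [exact: gideal_homog Jf|exact: gidealMl].
Qed.

(** The ideal J + (a). The first alternative covers the degrees below [e], where no multiple of [a]
    lives. *)
Definition gadd (J : nat -> set S) e (a : S) : nat -> set S :=
  fun m f => J m f \/ exists k g h,
    [/\ m = (e + k)%N, J m g, h \is k.-homog & f = g + a * h].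

Lemma gideal_add J e a : gideal J -> a \is e.-homog -> gideal (gadd J e a).
Proof.
move=> gJ ae; split.
- move=> m f [/(gideal_homog gJ)//|[k [g [h [-> Jg hk ->]]]]].
  by rewrite rpredD ?dhomogM // (gideal_homog gJ Jg).
- by move=> m; left; apply: gideal0.
- move=> m c f g Hf Hg.
  have {}Hf : gadd J e a m (c *: f).
    case: Hf => [Jf|[k [f1 [h [mE Jf hk ->]]]]]; [left; exact: gidealZ|right].
    exists k, (c *: f1), (c *: h); split=> //; first exact: gidealZ.
      by rewrite rpredZ.
    by rewrite scalerDr scalerAr.
  case: Hf => [Jf|[k [f1 [h [mE Jf hk ->]]]]].
    case: Hg => [Jg|[k [g1 [h [mE Jg hk ->]]]]]; [by left; apply: gidealD|right].
    by exists k, (c *: f + g1), h; split=> //; [apply: gidealD|rewrite addrA].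
  case: Hg => [Jg|[l [g1 [h' [mE' Jg hl ->]]]]]; right.
    by exists k, (f1 + g), h; split=> //; [apply: gidealD|rewrite addrAC].
  have kl : l = k by apply/eqP; rewrite -(eqn_add2l e) -mE -mE'.
  rewrite kl in hl; exists k, (f1 + g1), (h + h'); split=> //.
  + exact: gidealD.
  + by rewrite rpredD.
  + by rewrite mulrDr addrACA.
- move=> m k f g [Jf|[l [f1 [h [mE Jf hl ->]]]]] gk; [by left; apply: gidealMl|right].
  exists (k + l)%N, (g * f1), (g * h); split.
  + by rewrite mE addnCA.
  + exact: gidealMl.
  + exact: dhomogM.
  + by rewrite mulrDr mulrCA.
Qed.

Lemma gsub_add J e a : gsub J (gadd J e a).
Proof. by move=> m f; left. Qed.

Lemma gadd_mem J e a : gideal J -> gadd J e a e a.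
Proof.
move=> gJ; right; exists 0%N, 0, 1; split; rewrite ?addn0 ?add0r ?mulr1 //.
  exact: gideal0.
exact: dhomog1.
Qed.

(* Both inequalities for Hilbert functions below come from the exact sequence
   0 -> (S/(J : a))(-e) -> S/J -> S/(J + a) -> 0. *)
Lemma dim_gcolon J e a m : gideal J -> a \is e.-homog ->
  exists W : {vspace dh (e + m)},
    [/\ (forall h : dh m, exists2 w, w \in W & mpoly_of_dhomog w = a * mpoly_of_dhomog h),
        (forall w, w \in W -> exists h : dh m, mpoly_of_dhomog w = a * mpoly_of_dhomog h)
      & (\dim (gpart J (e + m) + W) + \dim (gpart (gcolon J e a) m) =
         \dim (gpart J (e + m)) + \dim (fullv : {vspace dh m}))%N].
Proof.
move=> gJ ae; pose mu (h : dh m) : dh (e + m) := DHomog (dhomogM ae (dhomog_is_dhomog h)).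
have mu_lin : linear mu.
  by move=> c f g; apply/val_inj => /=; rewrite mulrDr -scalerAr.
pose muL := GRing.isLinear.Build _ _ _ _ mu mu_lin.
pose muS : {linear dh m -> dh (e + m)} := HB.pack mu muL.
pose f := linfun muS.
have fE h : mpoly_of_dhomog (f h) = a * mpoly_of_dhomog h by rewrite lfunE.
exists (f @: fullv)%VS; split.
- by move=> h; exists (f h); rewrite ?fE // memv_img // memvf.
- by move=> w /memv_imgP[h _ ->]; exists h.
set V := gpart J (e + m); set C := gpart _ m.
have gC := gideal_colon e a gJ.
have kerC : (lker f <= C)%VS.
  apply/subvP => h; rewrite memv_ker => /eqP fh; apply/(gpartP _ gC).
  by split; [exact: dhomog_is_dhomog|rewrite -fE fh; apply: gideal0].
(* The multiples of [a] that lie in J are the image of the colon ideal, which contains the kernel;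
   rank-nullity on [C] and on the full space gives the count. *)
have VfE : (V :&: f @: fullv = f @: C)%VS.
  apply/vspaceP => w; rewrite memv_cap; apply/andP/memv_imgP => [[]|[h]].
    move=> Vw /memv_imgP[h _ we]; exists h => //; apply/(gpartP _ gC).
    by split; [exact: dhomog_is_dhomog|rewrite -fE -we; apply/(gpartP _ gJ)].
  move=> /(gpartP _ gC)[_ Jah] ->; split; last by rewrite memv_img // memvf.
  by apply/(gpartP _ gJ); rewrite fE.
have := dimv_sum_cap V (f @: fullv); rewrite VfE.
have := limg_ker_dim f C; have := limg_ker_dim f fullv.
rewrite capfv; have -> : (C :&: lker f = lker f)%VS by apply/capv_idPr.
have aux (k l t x c s v : nat) :
  (k + l = t -> k + x = c -> s + x = v + l -> s + c = v + t)%N by lia.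
exact: aux.
Qed.

Lemma hf_colon_le J K e a m : gideal J -> gideal K -> a \is e.-homog ->
  gsub J K -> K e a -> (hf K (e + m) + hf (gcolon J e a) m <= hf J (e + m))%N.
Proof.
move=> gJ gK ae JK Ka; have [W [_ W2 dE]] := dim_gcolon m gJ ae.
have WK : (gpart J (e + m) + W <= gpart K (e + m))%VS.
  rewrite subv_add gpartS //=.
  apply/subvP => w /W2[h wE]; apply/(gpartP _ gK).
  by rewrite wE; apply: (gidealMr gK (dhomog_is_dhomog h) Ka).
have := dimvS WK; have := dim_gpart_le J (e + m); have := dim_gpart_le K (e + m).
have := dim_gpart_le (gcolon J e a) m; rewrite /hf; lia.
Qed.

Lemma hf_colon_ge J e a m : gideal J -> a \is e.-homog ->
  (hf J (e + m) <= hf (gadd J e a) (e + m) + hf (gcolon J e a) m)%N.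
Proof.
move=> gJ ae; have [W [W1 _ dE]] := dim_gcolon m gJ ae.
have gA := gideal_add gJ ae.
have AW : (gpart (gadd J e a) (e + m) <= gpart J (e + m) + W)%VS.
  apply/subvP => f /(gpartP _ gA)[Jf|[k [g [h [kE Jg hk fE]]]]].
    by rewrite (subvP (addvSl _ _)) //; apply/gpartP.
  have km : k = m by apply/eqP; rewrite -(eqn_add2l e) -kE.
  rewrite km in hk; have [w Ww wE] := W1 (DHomog hk).
  have gm := gideal_homog gJ Jg.
  have -> : f = DHomog gm + w by apply/val_inj; rewrite /= fE wE.
  by apply: memv_add => //; apply/gpartP.
have := dimvS AW; have := dim_gpart_le J (e + m).
have := dim_gpart_le (gadd J e a) (e + m).
have := dim_gpart_le (gcolon J e a) m; rewrite /hf; lia.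
Qed.

(** The monomials of the initial ideal of J; the others are the standard monomials. *)
Definition glead (J : nat -> set S) (u : 'X_{1..n.+1}) : bool :=
  `[< exists f, [/\ J (mdeg u) f, f != 0 & mlead f = u] >].

(** Reading off the coefficients at the leading monomials of U is injective on U, which bounds the
    dimension above; forms with distinct leading monomials are free, which bounds it below. *)
Lemma dim_mlead m (U : {vspace dh m}) (s : seq 'X_{1..n.+1}) :
    uniq s -> (forall u, (u \in s) = (mdeg u == m)) ->
  \dim U = count (fun u => `[< exists f : dh m, [/\ f \in U, f != 0 & mlead f = u] >]) s.
Proof.
move=> us sE; set P := (X in count X).
pose t := filter P s.
have ut : uniq t by rewrite filter_uniq.
rewrite -size_filter -/t; apply/eqP; rewrite eqn_leq; apply/andP; split.
  pose phi (f : dh m) : 'rV[F]_(size t) := \row_i f@_(tnth (in_tuple t) i).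
  have phi_lin : linear phi.
    by move=> c f g; apply/rowP => i; rewrite !mxE linearP.
  pose phiS : {linear dh m -> 'rV[F]_(size t)} :=
    HB.pack phi (GRing.isLinear.Build _ _ _ _ phi phi_lin).
  have := limg_ker_dim (linfun phiS) U.
  have -> : (U :&: lker (linfun phiS) = 0)%VS.
    apply/eqP; rewrite -subv0; apply/subvP => f; rewrite memv_cap memv0 memv_ker.
    move=> /andP[Uf]; rewrite lfunE /= => /eqP/rowP f0; apply/negPn/negP => fn0.
    have fn0' : mpoly_of_dhomog f != 0 by apply: contraNneq fn0 => f00; apply/eqP/val_inj.
    have ft : mlead f \in t.
      rewrite mem_filter sE; apply/andP; split; first by apply/asboolP; exists f.
      by apply/eqP; apply: (dhomog_mf (dhomog_is_dhomog f)); apply: mlead_supp.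
    have it : (index (mlead f) t < size t)%N by rewrite index_mem.
    have := f0 (Ordinal it); rewrite !mxE (tnth_nth 0%MM) /= nth_index // => /eqP.
    by rewrite mleadc_eq0 (negPf fn0').
  rewrite dimv0 add0n => <-.
  by rewrite (leq_trans (dimvS (subvf _))) // dimvf /dim /= mul1n.
have ex u : exists f : dh m, P u -> [/\ f \in U, f != 0 & mlead f = u].
  by have [/asboolP[f ?]|?] := boolP (P u); [exists f|exists 0].
have [fc fcP] := choice ex.
pose X := [tuple fc (tnth (in_tuple t) i) | i < size t].
have PX i : P (tnth (in_tuple t) i).
  by have := mem_tnth i (in_tuple t); rewrite mem_filter => /andP[].
have XU : (<<X>> <= U)%VS.
  by apply/span_subvP => f /tnthP[i ->]; rewrite tnth_mktuple; case: (fcP _ (PX i)).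
have fX : free X.
  apply/freeP => k; under eq_bigr do rewrite -tnth_nth tnth_mktuple.
  move=> sum0 i0; apply/eqP/negPn/negP => ki0.
  (* Among the terms with nonzero coefficient, the largest leading monomial cannot be cancelled. *)
  case: (@Order.TotalTheory.arg_maxP _ _ _ i0 (fun i => k i != 0) (fun i => tnth (in_tuple t) i) ki0) => i ki imax.
  have [_ fi0 fiE] := fcP _ (PX i).
  have fi0' : mpoly_of_dhomog (fc (tnth (in_tuple t) i)) != 0.
    by apply: contraNneq fi0 => f00; apply/eqP/val_inj.
  have := congr1 (fun f : dh m => (mpoly_of_dhomog f)@_(tnth (in_tuple t) i)) sum0.
  rewrite /= linear_sum raddf_sum /= mcoeff0 (bigD1 i) //= big1 ?addr0 => [|j ji].
    rewrite mcoeffZ => /eqP.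
    have := mleadc_eq0 (mpoly_of_dhomog (fc (tnth (in_tuple t) i))).
    by rewrite fiE (negPf fi0') mulf_eq0 (negPf ki) => ->.
  rewrite mcoeffZ.
  have [->|kj] := eqVneq (k j) 0; first by rewrite mul0r.
  have [_ _ fjE] := fcP _ (PX j).
  rewrite mcoeff_gt_mlead ?mulr0 // fjE lt_neqAle -val_eqE /=.
  apply/andP; split; last exact: imax.
  by rewrite !(tnth_nth 0%MM) /= (inj_eq val_inj) nth_uniq.
by move: fX => /eqP; rewrite size_tuple => <-; apply: dimvS.
Qed.

(** Macaulay's theorem: an ideal and its initial ideal have the same Hilbert function. *)
Lemma hf_count J m (s : seq 'X_{1..n.+1}) : gideal J ->
    uniq s -> (forall u, (u \in s) = (mdeg u == m)) ->
  hf J m = count (predC (glead J)) s.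
Proof.
move=> gJ us sE; rewrite /hf !(dim_mlead _ us sE).
have -> : count (fun u => `[< exists f : dh m, [/\ f \in fullv, f != 0 & mlead f = u] >]) s = size s.
  apply/eqP; rewrite -all_count; apply/allP => u; rewrite sE => um.
  apply/asboolP; have um' : ('X_[u] : S) \is m.-homog by rewrite dhomogX.
  exists (DHomog um'); split; [exact: memvf| |by rewrite /= mleadXm].
  by apply/eqP => /(congr1 val) /= /eqP; rewrite -msupp_eq0 msuppX.
have -> : count (fun u => `[< exists f : dh m, [/\ f \in gpart J m, f != 0 & mlead f = u] >]) s = count (glead J) s.
  apply: eq_in_count => u; rewrite sE => /eqP um; apply: asbool_equiv_eq.
  split=> [[f [/(gpartP _ gJ) Jf f0 fu]]|[f [Jf f0 fu]]].
    by exists f; rewrite um; split.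
  rewrite um in Jf; exists (DHomog (gideal_homog gJ Jf)); split=> //.
  exact/gpartP.
by rewrite -(count_predC (glead J) s) addKn.
Qed.

Definition mnm_of_seq (s : seq nat) : 'X_{1..n.+1} := [multinom nth 0%N s i | i < n.+1].

Lemma mnm_of_seqK (u : 'X_{1..n.+1}) : mnm_of_seq (val u) = u.
Proof. by apply/mnmP => i; rewrite mnmE (mnm_nth 0%N). Qed.

Lemma seq_of_mnmK s : size s = n.+1 -> val (mnm_of_seq s) = s :> seq nat.
Proof.
move=> ss; apply: (@eq_from_nth _ 0%N); rewrite size_tuple // => i ni.
have := mnmE (fun i : 'I_n.+1 => nth 0%N s i) (Ordinal ni).
by rewrite (mnm_nth 0%N).
Qed.

Lemma mdeg_mnm_of_seq s : size s = n.+1 -> mdeg (mnm_of_seq s) = sumn s.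
Proof. by move=> ss; rewrite /mdeg -{2}(seq_of_mnmK ss) sumnE. Qed.

Lemma hf_monos J m : gideal J ->
  hf J m = count (predC (glead J \o mnm_of_seq)) (monos n.+1 m).
Proof.
move=> gJ; rewrite (hf_count gJ (s := [seq mnm_of_seq s | s <- monos n.+1 m])).
- by rewrite count_map.
- rewrite map_inj_in_uniq ?monos_uniq // => s t.
  rewrite !mem_monos => /andP[/eqP ss _] /andP[/eqP st _] e.
  by rewrite -(seq_of_mnmK ss) -(seq_of_mnmK st) e.
- move=> u; apply/mapP/eqP => [[s]|<-].
    by rewrite mem_monos => /andP[/eqP ss /eqP sm] ->; rewrite mdeg_mnm_of_seq.
  exists (val u : seq nat); last by rewrite mnm_of_seqK.
  by rewrite mem_monos size_tuple eqxx /= -mdeg_mnm_of_seq ?size_tuple // mnm_of_seqK.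
Qed.

Lemma glead_up_closed J : gideal J -> up_closed n.+1 (glead J \o mnm_of_seq).
Proof.
move=> gJ s t ss st le /asboolP[f [Jf f0 fs]]; apply/asboolP.
have lem : (mnm_of_seq s <= mnm_of_seq t)%MM.
  apply/mnm_lepP => i; rewrite !mnmE.
  have : (i < size s)%N by rewrite ss.
  elim: s t i le {ss st Jf fs} => [|x s IH] [|y t] //= [[|i] /= Hi] /andP[xy le] // si.
  by apply: (IH t (Ordinal (ltnW Hi)) le).
have X0 : 'X_[mnm_of_seq t - mnm_of_seq s] != 0 :> S.
  by rewrite -msupp_eq0 msuppX.
exists ('X_[mnm_of_seq t - mnm_of_seq s] * f); split.
- rewrite -{1}(submK lem) mdegD; apply: gidealMl => //.
  by rewrite dhomogX.
- by rewrite mulf_neq0.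
- by rewrite mleadM // mleadXm fs submK.
Qed.

Lemma hf_poly J : gideal J -> exists P, eventually_poly (hf J) P.
Proof.
move=> gJ; have [P HP] := up_closed_count_poly (glead_up_closed gJ).
exists P; apply: eventually_poly_ext HP; exists 0%N => m _.
by rewrite (hf_monos _ gJ).
Qed.

(** Noetherianity by initial ideals: along a strictly increasing chain they stabilise, then two
    successive ideals have equal Hilbert functions and coincide. *)
Lemma gideal_max (P : (nat -> set S) -> Prop) J0 :
    (forall J, P J -> gideal J) -> P J0 ->
  exists J, [/\ P J, gsub J0 J & forall K, P K -> gsub J K -> gsub K J].
Proof.
move=> Pg PJ0; apply: contrapT => /forallNP nomax.
have step (J : nat -> set S) : exists K, P J -> gsub J0 J -> [/\ P K, gsub J K & ~ gsub K J].
  have [[PJ J0J]|nPJ] := pselect (P J /\ gsub J0 J); last by exists J => ? ?; case: nPJ.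
  have := nomax J; move=> /not_and3P[//|//|/existsNP[K /not_implyP[PK /not_implyP[JK nKJ]]]].
  by exists K.
have [c cP] := choice step.
pose J := fix J i := if i is i'.+1 then c (J i') else J0.
have JP i : P (J i) /\ gsub J0 (J i).
  elim: i => [|i [IH1 IH2]]; first by split.
  by have [? H _] := cP _ IH1 IH2; split=> // m f /IH2/H.
have [||K KP] := @up_closed_stable n.+1 (fun i => glead (J i) \o mnm_of_seq).
- by move=> i; apply/glead_up_closed/Pg; case: (JP i).
- move=> i s ss /asboolP[f [Jf f0 fs]]; apply/asboolP; exists f; split=> //.
  by have [PJ J0J] := JP i; have [_ H _] := cP _ PJ J0J; apply: H.
have [PK J0K] := JP K; have [PK' JK nKJ] := cP _ PK J0K; apply: nKJ.
apply: gsub_hf_eq => //; [exact: Pg|exact: Pg|] => m.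
rewrite !hf_monos //; [|exact: Pg|exact: Pg].
apply: sub_in_count => s; rewrite mem_monos => /andP[/eqP ss _].
by apply: contra; apply: (KP K.+1).
Qed.

End GradedIdeals.

(** * Graded primes and the degree of the Hilbert polynomial *)

Section GradedPrimes.
Variables (F : fieldType) (n : nat).
Local Notation S := {mpoly F[n.+1]}.
Local Notation dh m := (dhomog n.+1 F m).
Implicit Types J K : nat -> set S.

(** Primality is tested on forms. The unit ideal and the irrelevant ideal both qualify; [hp J != 0]
    rules them out where it matters. *)
Definition gprime J : Prop :=
  gideal J /\ forall k l a b, a \is k.-homog -> b \is l.-homog ->
    J (k + l)%N (a * b) -> J k a \/ J l b.

Definition hp J : {poly rat} := xget 0 [set P | eventually_poly (hf J) P].

Lemma hpP J : gideal J -> eventually_poly (hf J) (hp J).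
Proof. by move=> gJ; rewrite /hp; case: xgetP => // none; have [P /none] := hf_poly gJ. Qed.

Lemma hp_lc_ge0 J : gideal J -> 0 <= lead_coef (hp J).
Proof. by move=> /hpP; apply: eventually_poly_lc_ge0. Qed.

Lemma size_hpS J K : gideal J -> gideal K -> gsub J K -> (size (hp K) <= size (hp J))%N.
Proof.
move=> gJ gK JK; have [] // := eventually_poly_le (hpP gK) (hpP gJ).
by exists 0%N => m _; apply: hfS.
Qed.

Lemma hf_colon_prime J e a m : gprime J -> a \is e.-homog -> ~ J e a ->
  hf (gcolon J e a) m = hf J m.
Proof.
move=> [gJ pJ] ae nJa; apply/eqP; rewrite eqn_leq; apply/andP; split.
  by apply: hfS => //; [exact: gideal_colon|exact: gsub_colon].
apply: hfS => //; first exact: gideal_colon.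
by move=> k f [fk Jaf]; case: (pJ _ _ _ _ ae fk Jaf).
Qed.

(** As J : a = J, the exact sequence bounds the Hilbert function of K at m + e by the increment of
    that of J from m to m + e, and a difference polynomial has smaller degree. *)
Lemma size_hp_lt J K e a : gprime J -> gideal K -> gsub J K -> a \is e.-homog ->
  K e a -> ~ J e a -> hp J != 0 -> (size (hp K) < size (hp J))%N.
Proof.
move=> pJ gK JK ae Ka nJa hp0; have [gJ _] := pJ.
apply: leq_ltn_trans (size_diff_poly_lt e%:R hp0).
rewrite -(size_shift e%:R (hp K)); apply: (proj1 (poly_ev_le _ _)).
  by rewrite lead_coef_shift hp_lc_ge0.
have [N HN] := eventually_poly_shiftD e (hpP gK).
have [M HM] := eventually_poly_shiftD e (hpP gJ).
have [L HL] := hpP gJ.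
exists (maxn N (maxn M L)) => m; rewrite !geq_max => /and3P[Nm Mm Lm].
rewrite HN // hornerD hornerN HM // HL // lerBrDr -natrD ler_nat.
rewrite [(m + e)%N]addnC -(hf_colon_prime m pJ ae nJa).
exact: hf_colon_le.
Qed.

(** The counterpart of Krull's principal ideal theorem: one equation lowers the degree by at most
    one, since the difference polynomial with step e > 0 loses exactly one. *)
Lemma size_hp_add_ge J e a d : gprime J -> a \is e.-homog -> (0 < e)%N ->
  ~ J e a -> size (hp J) = d.+2 -> (d < size (hp (gadd J e a)))%N.
Proof.
move=> pJ ae e0 nJa sJ; have [gJ _] := pJ; have gA := gideal_add gJ ae.
have e0' : e%:R != 0 :> rat by rewrite pnatr_eq0 -lt0n.
have [sd lcd] := size_lc_diff_poly e0' sJ.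
rewrite -sd -(size_shift e%:R (hp (gadd J e a))); apply: (proj1 (poly_ev_le _ _)).
  by rewrite lcd !mulr_ge0 ?ler0n // hp_lc_ge0.
have [N HN] := eventually_poly_shiftD e (hpP gA).
have [M HM] := eventually_poly_shiftD e (hpP gJ).
have [L HL] := hpP gJ.
exists (maxn N (maxn M L)) => m; rewrite !geq_max => /and3P[Nm Mm Lm].
rewrite HN // hornerD hornerN HM // HL // lerBlDr -natrD ler_nat.
rewrite [(m + e)%N]addnC -(hf_colon_prime m pJ ae nJa).
exact: hf_colon_ge.
Qed.

(* A maximal ideal with this property is prime: if ab is in J, then J + (a) and J : a
   have Hilbert polynomials of smaller degree, unless one of them is J. *)
Lemma exists_prime_size_hp J0 d : gideal J0 -> (0 < d <= size (hp J0))%N ->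
  exists J, [/\ gprime J, gsub J0 J & (d <= size (hp J))%N].
Proof.
move=> gJ0 /andP[d0 dJ0].
have [||J [[gJ dJ] J0J Jmax]] := @gideal_max _ _ (fun K => gideal K /\ (d <= size (hp K))%N) J0.
- by move=> K [].
- by [].
exists J; split=> //; split=> // k l a b ak bl Jab.
apply: contrapT => /not_orP[nJa nJb].
have gA := gideal_add gJ ak; have gC := gideal_colon k a gJ.
have sA : (size (hp (gadd J k a)) < d)%N.
  rewrite ltnNge; apply/negP => dA; apply: nJa.
  by apply: (Jmax _ (conj gA dA)); [exact: gsub_add|exact: gadd_mem].
have sC : (size (hp (gcolon J k a)) < d)%N.
  rewrite ltnNge; apply/negP => dC; apply: nJb.
  by apply: (Jmax _ (conj gC dC)); [exact: gsub_colon|].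
have HA := eventually_poly_shiftD k (hpP gA).
have [] := eventually_poly_le (eventually_poly_shiftD k (hpP gJ)) (eventually_polyD HA (hpP gC)).
  by exists 0%N => m _; rewrite [(m + k)%N]addnC; exact: hf_colon_ge.
rewrite size_shift => le _; have := leq_trans dJ (leq_trans le (size_polyD _ _)).
by rewrite size_shift leq_max leqNgt sA leqNgt sC.
Qed.

Lemma gideal_mono J m f : gideal J -> f \is m.-homog ->
  (forall u, mdeg u = m -> f@_u != 0 -> J m 'X_[u]) -> J m f.
Proof.
move=> gJ fm Ju; rewrite (mpolyE f) big_seq; apply: gideal_sum => // u uf.
apply: gidealZ => //; apply: Ju; first exact: (dhomog_mf fm uf).
by rewrite -mcoeff_msupp.
Qed.

(** Otherwise J contains every monomial of positive degree and its Hilbert function is eventually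
    zero. *)
Lemma exists_notin_var J : gideal J -> hp J != 0 -> exists i, ~ J 1%N 'X_i.
Proof.
move=> gJ; apply: contra_neqP => /forallNP allJ.
have {}allJ i : J 1%N 'X_i by have /contrapT := allJ i.
apply: (eventually_poly_uniq (hpP gJ)).
apply: eventually_poly_ext eventually_poly0; exists 1%N => m m0.
apply/esym/eqP; rewrite -leqn0 leq_subLR addn0; apply/dimvS/subvP => f _.
apply/gpartP => //; apply: (gideal_mono gJ (dhomog_is_dhomog f)) => u um _.
have /existsP[i ui] : [exists i, u i != 0%N].
  apply: contraLR m0; rewrite negb_exists => /forallP u0.
  rewrite -um lt0n negbK mdeg_eq0; apply/eqP/mnmP => i.
  by rewrite mnm0E; apply/eqP; have := u0 i; rewrite negbK.
have le : (U_(i) <= u)%MM by rewrite lep1mP.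
rewrite -(submK le) mpolyXD -um -{1}(submK le) mdegD mdeg1.
by apply: gidealMl => //; rewrite dhomogX.
Qed.

End GradedPrimes.

(** * The projective Nullstellensatz *)

Section Nullstellensatz.
Variables (F : closedFieldType) (n : nat).
Local Notation S := {mpoly F[n.+1]}.
Local Notation dh m := (dhomog n.+1 F m).
Implicit Types J K : nat -> set S.

(** This is b^M q(a / b), the binary form of degree M attached to q, evaluated at [a] and [b]. *)
Definition homogenize (a b : S) (M : nat) (q : {poly F}) : S :=
  \sum_(t < M.+1) q`_t *: (a ^+ t * b ^+ (M - t)).

Lemma homogenize_sum a b M (I : finType) (c : I -> F) (q : I -> {poly F}) :
  homogenize a b M (\sum_i c i *: q i) = \sum_i c i *: homogenize a b M (q i).
Proof.
rewrite /homogenize; under [RHS]eq_bigr do rewrite scaler_sumr.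
rewrite exchange_big; apply: eq_bigr => t _ /=.
rewrite coef_sum scaler_suml; apply: eq_bigr => i _.
by rewrite coefZ scalerA.
Qed.

Lemma homogenize_widen a b M (q : {poly F}) : (size q <= M.+1)%N ->
  homogenize a b M.+1 q = b * homogenize a b M q.
Proof.
move=> sq; rewrite /homogenize big_ord_recr /= (leq_sizeP _ _ sq) // scale0r addr0.
rewrite mulr_sumr; apply: eq_bigr => t _.
by rewrite -scalerAr mulrCA -exprS subSn // -ltnS.
Qed.

Lemma homogenizeM a b M (q : {poly F}) c : (size q <= M.+1)%N ->
  homogenize a b M.+1 (('X - c%:P) * q) = (a - c *: b) * homogenize a b M q.
Proof.
move=> sq; have -> : (a - c *: b) * homogenize a b M q =
    a * homogenize a b M q - c *: homogenize a b M.+1 q.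
  by rewrite homogenize_widen // [LHS]mulrBl scalerAl.
rewrite mulrBl.
rewrite /homogenize; under eq_bigr do rewrite coefB coefCM coefXM scalerBl.
rewrite sumrB scaler_sumr; congr (_ - _); last first.
  by apply: eq_bigr => t _; rewrite scalerA.
rewrite big_ord_recl /= scale0r add0r mulr_sumr; apply: eq_bigr => t _.
by rewrite /= /bump /= add1n subSS -scalerAr mulrA -exprS.
Qed.

Lemma homogenize_prod a b (s : seq F) :
  homogenize a b (size s) (\prod_(c <- s) ('X - c%:P)) = \prod_(c <- s) (a - c *: b).
Proof.
elim: s => [|c s IH].
  by rewrite !big_nil /homogenize big_ord1 coef1 !expr0 mulr1 scale1r.
by rewrite !big_cons homogenizeM ?IH // size_prod_XsubC.
Qed.

(* [None] stands for the factor [b], i.e. for a root at infinity. *)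
Definition linear_factor (a b : S) (o : option F) : S :=
  if o is Some c then a - c *: b else b.

(** Each root c of q gives a factor a - c b, and the defect of the degree of q with respect to M
    gives factors b. *)
Lemma homogenize_split a b M (q : {poly F}) : q != 0 -> (size q <= M.+1)%N ->
  exists2 s : seq (option F), size s = M &
    homogenize a b M q = lead_coef q *: \prod_(o <- s) linear_factor a b o.
Proof.
move=> q0 sq; have [s qE] := closed_field_poly_normal q.
have ss : size q = (size s).+1.
  by rewrite qE size_scale ?lead_coef_eq0 // size_prod_XsubC.
have sM : (size s + (M - size s))%N = M by rewrite subnKC // -ltnS -ss.
exists (nseq (M - size s) None ++ [seq Some c | c <- s]).
  by rewrite size_cat size_nseq size_map addnC.
have -> : homogenize a b M q = lead_coef q *: homogenize a b M (\prod_(c <- s) ('X - c%:P)).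
  rewrite {1}qE /homogenize scaler_sumr; apply: eq_bigr => t _.
  by rewrite coefZ scalerA.
congr (_ *: _); rewrite -[in LHS]sM big_cat big_map /= -homogenize_prod.
elim: (M - size s)%N => [|k IH]; first by rewrite addn0 big_nil mul1r.
by rewrite addnS homogenize_widen ?IH /= ?big_cons ?mulrA // size_prod_XsubC ltnS leq_addr.
Qed.

(* A consequence of uncountability, the only one that the Nullstellensatz needs. *)
Definition infinite_fibre : Prop := forall kappa : F -> nat, exists k,
  forall N, exists s : N.-tuple F, uniq s /\ forall x, x \in s -> kappa x = k.

Variable F_unc : infinite_fibre.

Lemma gprime_prod K m (I : Type) (s : seq I) (f : I -> S) : gprime K ->
  ~ K 0%N 1 -> (forall i, f i \is m.-homog) ->
  K (m * size s)%N (\prod_(i <- s) f i) -> exists i, K m (f i).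
Proof.
move=> [gK pK] nK1 fm; elim: s => [|i s IH] /=; first by rewrite big_nil muln0.
rewrite big_cons mulnS => /pK[//| |Ki|/IH//]; last by exists i.
elim: {IH} s => [|j s IH]; first by rewrite big_nil muln0 dhomog1.
by rewrite big_cons /= mulnS; apply: dhomogM.
Qed.

Lemma dhomog_prod_seq m (I : Type) (s : seq I) (f : I -> S) :
  (forall i, f i \is m.-homog) -> \prod_(i <- s) f i \is (m * size s).-homog.
Proof.
move=> fm; elim: s => [|j s IH]; first by rewrite big_nil muln0 dhomog1.
by rewrite big_cons /= mulnS; apply: dhomogM.
Qed.

(* Otherwise every a - c b divides a power of f modulo K, and for infinitely many c
   it is the same power.  By dimension finitely many of the quotients are linearly
   dependent, and clearing denominators gives a nonzero binary form in a and b that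
   lies in the prime K, hence so does one of its linear factors. *)
Lemma gprime_linear_dep K e (f : S) m (a b : S) : gprime K -> f \is e.-homog ->
    (forall k, ~ K (e * k)%N (f ^+ k)) ->
    (forall l c, c \is l.-homog -> ~ K l c ->
       exists k, gadd K l c (e * k)%N (f ^+ k)) ->
    a \is m.-homog -> b \is m.-homog -> ~ K m b ->
  exists c, K m (a - c *: b).
Proof.
move=> pK fe fK fadd am bm nKb; have [gK ppK] := pK.
apply: contrapT => /forallNP nK.
have abm c : a - c *: b \is m.-homog by rewrite rpredB ?rpredZ.
have [kappa kP] := choice (fun c => fadd _ _ (abm c) (nK c)).
have [k kE] := F_unc kappa.
have nK1 : ~ K 0%N 1 by have := fK 0%N; rewrite muln0.
(* [D] is the degree of the quotients of f^k by the a - x b; the subtraction is exact, as [jE] shows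
   below. With one more quotient than the dimension of that space, they are linearly dependent. *)
pose D := (e * k - m)%N; pose N' := \dim (fullv : {vspace dh D}); pose N := N'.+1.
have [s [us sk]] := kE N.
have ex (i : 'I_N) : exists h : dh D,
    K (e * k)%N (f ^+ k - (a - tnth s i *: b) * mpoly_of_dhomog h).
  have := kP (tnth s i); rewrite sk ?mem_tnth // => -[/fK//|[j [g [h [jE Kg hj fE]]]]].
  have jD : j = D by rewrite /D jE addKn.
  by rewrite jD in hj; exists (DHomog hj); rewrite fE addrK.
have [h hP] := choice ex.
have [c sum0 [i0 ci0]] : exists2 c : 'I_N -> F, \sum_i c i *: h i = 0 & exists i, c i != 0.
  have nfree : ~~ free [tuple h i | i < N].
    apply/negP => /eqP; rewrite size_tuple => dimN.
    by have := dimvS (subvf <<[tuple h i | i < N]>>); rewrite dimN ltnn.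
  apply: contrapT => noc; move/negP: nfree; apply.
  apply/freeP => c; under eq_bigr do rewrite -tnth_nth tnth_mktuple.
  move=> sum0 i; apply/eqP/negPn/negP => ci; apply: noc.
  by exists c => //; exists i.
pose s' i := [seq tnth s j | j <- index_enum 'I_N & j != i].
have ss' i : size (s' i) = N'.
  by rewrite size_map size_filter -sum1_count sum1_card cardC1 card_ord.
(* The numerator of the sum of the c_i / (X - s_i). At the root s_i0 only the term of index [i0]
   survives, so q is nonzero. *)
pose q := \sum_i c i *: \prod_(x <- s' i) ('X - x%:P).
have sq : (size q <= N'.+1)%N.
  apply: (leq_trans (size_sum _ _ _)); apply/bigmax_leqP => i _.
  by apply: (leq_trans (size_scale_leq _ _)); rewrite size_prod_XsubC ss'.
have q0 : q != 0.
  apply/eqP => /(congr1 (fun q => q.[tnth s i0])); apply/eqP.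
  rewrite horner0 horner_sum (bigD1 i0) //= [X in _ + X]big1 ?addr0 => [|i ii0].
    rewrite hornerZ mulf_neq0 // horner_prod big_map big_filter.
    rewrite prodf_seq_neq0; apply/allP => j _; apply/implyP => ji.
    rewrite hornerXsubC subr_eq0 !(tnth_nth 0) nth_uniq ?size_tuple //.
    by rewrite eq_sym.
  rewrite hornerZ; apply/eqP; rewrite mulf_eq0; apply/orP; right.
  rewrite horner_prod big_map big_filter (bigD1 i0) 1?eq_sym //=.
  by rewrite hornerXsubC subrr mul0r.
pose L := homogenize a b N' q.
have LE : L = \sum_i c i *: \prod_(x <- s' i) (a - x *: b).
  rewrite /L /q homogenize_sum; apply: eq_bigr => i _.
  by rewrite -(ss' i) homogenize_prod.
have prodm i : \prod_(x <- s' i) (a - x *: b) \is (m * N')%N.-homog.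
  by rewrite -(ss' i); apply: dhomog_prod_seq.
have Lm : L \is (m * N')%N.-homog.
  by rewrite LE rpred_sum // => i _; rewrite rpredZ.
(* Each f^k - (a - s_i b) h_i is in K. Weighted by c_i and the product over the other roots, these
   add up to f^k L minus the full product times the sum of the c_i h_i, which is zero. *)
have /ppK : K (e * k + m * N')%N (f ^+ k * L).
  have -> : f ^+ k * L = \sum_i c i *:
      ((f ^+ k - (a - tnth s i *: b) * mpoly_of_dhomog (h i)) * \prod_(x <- s' i) (a - x *: b)).
    apply/eqP; rewrite LE mulr_sumr -subr_eq0 -sumrB.
    have P_eq i : (a - tnth s i *: b) * \prod_(x <- s' i) (a - x *: b) =
        \prod_(j < N) (a - tnth s j *: b).
      by rewrite [RHS](bigD1 i) //= big_map big_filter.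
    rewrite (eq_bigr (fun i => \prod_(j < N) (a - tnth s j *: b) * (c i *: mpoly_of_dhomog (h i)))).
      rewrite -mulr_sumr; have := congr1 (@mpoly_of_dhomog _ _ _) sum0.
      rewrite linear_sum /= => ->; by rewrite mulr0.
    move=> i _; rewrite -scalerAr -scalerBr -mulrBl opprB addrC subrK -(P_eq i).
    by rewrite -scalerAr; congr (_ *: _); rewrite mulrAC.
  by apply: gideal_sum => // i _; apply: gidealZ => //; apply: gidealMr.
case=> [| |/fK//|]; [exact: dhomogMn|exact: Lm|].
have [o so] := homogenize_split a b q0 sq; rewrite -/L => -> KL.
have {KL} : K (m * size o)%N (\prod_(x <- o) linear_factor a b x).
  rewrite so -[X in K _ X]scale1r -(mulVf (_ : lead_coef q != 0)) ?lead_coef_eq0 //.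
  by rewrite -scalerA; apply: gidealZ.
move=> /(gprime_prod pK nK1)[[x|]|[x|]] //=.
  exact: nK.
Qed.

(* An ideal K maximal among those that contain J and no power of x_i f is prime, and
   its quotient is at most one-dimensional in each degree; the point p is given by
   x_j = p_j x_i modulo K. *)
Lemma nullstellensatz J e (f : S) : gprime J -> (exists i, ~ J 1%N 'X_i) ->
    f \is e.-homog -> ~ J e f ->
  exists p : 'I_n.+1 -> F, [/\ exists i, p i != 0,
    forall m g, J m g -> g.@[p] = 0 & f.@[p] != 0].
Proof.
move=> [gJ pJ] [i nJi] fe nJf.
have Xhom j : ('X_j : S) \is 1.-homog by rewrite dhomogX; apply/eqP; exact: mdeg1.
pose f' := 'X_i * f; pose e' := (1 + e)%N.
have fe' : f' \is e'.-homog by apply: dhomogM.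
have nJf' k : ~ J (e' * k)%N (f' ^+ k).
  elim: k => [|k IH].
    rewrite muln0 expr0 => J1; apply: nJi.
    by rewrite -[1%N]addn0 -['X_i]mulr1; apply: gidealMl.
  rewrite mulnS exprS => /pJ[|//|/pJ[|//||]|/IH//] //.
  exact: dhomogMn.
have [K [[gK nKf'] JK Kmax]] := @gideal_max _ _
  (fun K => gideal K /\ forall k, ~ K (e' * k)%N (f' ^+ k)) J (fun K => @proj1 _ _) (conj gJ nJf').
have avoid l c : c \is l.-homog -> ~ K l c -> exists k, gadd K l c (e' * k)%N (f' ^+ k).
  move=> cl nKc; apply: contrapT => /forallNP nf; apply: nKc.
  by apply: (Kmax _ (conj (gideal_add gK cl) nf)); [exact: gsub_add|exact: gadd_mem].
have pK : gprime K.
  split=> // k l a b ak bl Kab; apply: contrapT => /not_orP[nKa nKb].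
  have [k1 [/nKf'//|[i1 [g1 [h1 [E1 Kg1 hi1 f1]]]]]] := avoid _ _ ak nKa.
  have [k2 [/nKf'//|[i2 [g2 [h2 [E2 Kg2 hi2 f2]]]]]] := avoid _ _ bl nKb.
  apply: (nKf' (k1 + k2)%N); rewrite mulnDr exprD.
  have -> : f' ^+ k1 * f' ^+ k2 = g1 * f' ^+ k2 + (a * h1) * g2 + (a * b) * (h1 * h2).
    by rewrite f1 f2; ring.
  apply: gidealD => //.
    apply: gidealD => //; first by apply: gidealMr => //; apply: dhomogMn.
    by apply: gidealMl => //; rewrite E1; apply: dhomogM.
  rewrite E1 E2 addnACA; apply: gidealMr => //; exact: dhomogM.
have nKi : ~ K 1%N 'X_i.
  by move=> Ki; apply: (nKf' 1%N); rewrite muln1 expr1; apply: gidealMr.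
have ex j : exists c, K 1%N ('X_j - c *: 'X_i).
  exact: (gprime_linear_dep pK fe' nKf' avoid).
have [p pP] := choice ex.
have Xihom k : ('X_i ^+ k : S) \is k.-homog.
  by have := dhomogMn k (Xhom i); rewrite mul1n.
have nKXi m : ~ K m ('X_i ^+ m).
  elim: m => [|m IH]; first by have := nKf' 0%N; rewrite muln0.
  by rewrite exprS -add1n => /(proj2 pK)[|||].
(* Modulo K a monomial is its value at [p] times a power of X_i; this is stable under products, so
   the case of the variables suffices. *)
pose Q u := K (mdeg u) ('X_[u] - 'X_[u].@[p] *: 'X_i ^+ mdeg u).
have Q0 : Q 0%MM.
  by rewrite /Q mpolyX0 mdeg0 meval1 scale1r expr0 subrr; apply: gideal0.
have QD u1 u2 : Q u1 -> Q u2 -> Q (u1 + u2)%MM.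
  move=> H1 H2; rewrite /Q.
  have -> : 'X_[u1 + u2] - 'X_[u1 + u2].@[p] *: 'X_i ^+ mdeg (u1 + u2) =
     ('X_[u1] - 'X_[u1].@[p] *: 'X_i ^+ mdeg u1) * 'X_[u2] +
     ('X_[u1].@[p] *: 'X_i ^+ mdeg u1) * ('X_[u2] - 'X_[u2].@[p] *: 'X_i ^+ mdeg u2).
    rewrite mpolyXD mevalM mdegD exprD -!mul_mpolyC rmorphM /=; ring.
  rewrite mdegD; apply: gidealD => //.
    by apply: gidealMr => //; rewrite dhomogX.
  by apply: gidealMl => //; rewrite rpredZ.
have QU j : Q U_(j)%MM by rewrite /Q mdeg1 mevalXU expr1.
have evalX u : Q u.
  rewrite (multinomUE_id u); apply: big_ind => // j _.
  by elim: (u j) => [|k IH]; rewrite ?mulm0n ?mulmS //; apply: QD.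
have evalK m g : g \is m.-homog -> K m (g - g.@[p] *: 'X_i ^+ m).
  move=> gm; have -> : g - g.@[p] *: 'X_i ^+ m =
      \sum_(u <- msupp g) g@_u *: ('X_[u] - 'X_[u].@[p] *: 'X_i ^+ m).
    rewrite {1}(mpolyE g) {3}(mpolyE g) raddf_sum /= scaler_suml -sumrB.
    by apply: eq_bigr => u _; rewrite mevalZ scalerBr scalerA.
  rewrite big_seq; apply: gideal_sum => // u ug; apply: gidealZ => //.
  by have <- := dhomog_mf gm ug; apply: evalX.
(* A form of degree m is congruent to its value at [p] times X_i^m. As no power of X_i is in K, a
   form is in K exactly when it vanishes at [p]. *)
exists p; split.
- exists i; apply/eqP => pi0; have := pP i; rewrite pi0 scale0r subr0; exact: nKi.
- move=> m g Jg; apply/eqP/negPn/negP => gp0; apply: (nKXi m).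
  have Kg := JK _ _ Jg; have := gidealB gK Kg (evalK _ _ (gideal_homog gJ Jg)).
  rewrite opprB addrC subrK => /(gidealZ (g.@[p])^-1 gK).
  by rewrite scalerA mulVf // scale1r.
- apply/eqP => fp0; have := evalK _ _ fe; rewrite fp0 scale0r subr0 => Kf.
  by apply: (nKf' 1%N); rewrite muln1 expr1; apply: gidealMl.
Qed.

End Nullstellensatz.

(** Cantor's nested intervals; the supremum of the left ends lies in all of them. *)
Lemma real_not_enumerable (R : realType) (f : nat -> R) : exists x, forall k, f k != x.
Proof.
(* If f k is at most the midpoint, the last quarter lies strictly to its right; otherwise the closed
   left half lies strictly to its left. *)
pose step (k : nat) (ab : R * R) : R * R :=
  if f k <= (ab.1 + ab.2) / 2 then ((ab.1 + 3 * ab.2) / 4, ab.2)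
  else (ab.1, (ab.1 + ab.2) / 2).
pose I := fix I k := if k is k'.+1 then step k' (I k') else (0, 1 : R).
have Ilt k : (I k).1 < (I k).2.
  elim: k => [|k IH] /=; first exact: ltr01.
  by rewrite /step; case: ifP => _ /=; lra.
have IS k : (I k).1 <= (I k.+1).1 /\ (I k.+1).2 <= (I k).2.
  by have := Ilt k; rewrite /= /step; case: ifP => _ /=; lra.
have Imono j k : (j <= k)%N -> (I j).1 <= (I k).1 /\ (I k).2 <= (I j).2.
  elim: k => [|k IH]; first by rewrite leqn0 => /eqP ->.
  rewrite leq_eqVlt => /orP[/eqP->//|/IH[le1 le2]].
  by have [? ?] := IS k; split; [exact: le_trans le1 _|exact: le_trans le2].
have Icross j k : (I j).1 <= (I k).2.
  have [[le1 _] [_ le2]] := (Imono _ _ (leq_maxl j k), Imono _ _ (leq_maxr j k)).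
  exact: le_trans le1 (le_trans (ltW (Ilt _)) le2).
pose E := [set (I k).1 | k in [set: nat]]%classic.
have E0 : (E !=set0)%classic by exists (I 0%N).1, 0%N.
have Esup : has_sup E.
  by split=> //; exists (I 0%N).2 => _ [k _ <-]; exact: Icross.
exists (sup E) => k; apply/eqP => fk.
have le1 : (I k.+1).1 <= sup E by apply: sup_upper_bound => //; exists k.+1.
have le2 : sup E <= (I k.+1).2 by apply: ge_sup => // _ [j _ <-]; exact: Icross.
move: le1 le2; rewrite -fk /= /step; have := Ilt k; case: ifPn => /=; lra.
Qed.

(** Otherwise the fibres over the real line are finite and the reals are a countable union of finite
    sets. *)
Lemma complex_infinite_fibre (R : realType) : infinite_fibre R[i].
Proof.
move=> kappa; apply: contrapT => /forallNP fin.
pose A k := [set x : R | kappa x%:C%C = k]%classic.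
have Afin k : finite_set (A k).
  apply: contrapT => infA; apply: (fin k) => N.
  have [B BA NB] := infinite_set_fset N infA.
  pose s := take N [seq x%:C%C | x <- enum_fset B].
  have sN : size s == N by rewrite size_takel ?size_map.
  exists (Tuple sN); split.
    by rewrite take_uniq // map_inj_uniq ?fset_uniq // => x y [].
  by move=> x /mem_take /mapP[y yB ->]; apply: (BA y).
have cR : countable [set: R]%classic.
  have -> : [set: R]%classic = (\bigcup_k A k)%classic.
    by apply/seteqP; split=> // x _; exists (kappa x%:C%C).
  by apply: bigcup_countable => // k _; apply: finite_set_countable.
have /countable_injP[g gP] := cR.
have ex k : exists x, (exists y, g y = k) -> g x = k.
  by have [[x xk]|none] := pselect (exists x, g x = k); [exists x|exists 0].
have [f fP] := choice ex.
have [x xP] := real_not_enumerable f.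
have /eqP := xP (g x); apply; apply: gP; rewrite ?inE //.
by apply: fP; exists x.
Qed.

(** * Projective varieties *)

Local Open Scope classical_set_scope.
Local Open Scope quotient_scope.

Section Varieties.
Variables (R : realType) (n : nat).
Local Notation C := R[i].
Local Notation Pn := (projspace R n).
Local Notation S := {mpoly C[n.+1]}.
Local Notation coords v := (fun i => val v 0 i).
Implicit Types (X Y Z : set Pn) (J K : nat -> set S).

Lemma dhomog_meval_scale m (f : S) (c : C) (x : 'I_n.+1 -> C) : f \is m.-homog ->
  f.@[fun i => c * x i] = c ^+ m * f.@[x].
Proof.
move=> fm; rewrite !mevalE mulr_sumr big_seq [RHS]big_seq; apply: eq_bigr => u uf.
under eq_bigr do rewrite exprMn.
rewrite big_split /= prodrXr -mdegE (dhomog_mf fm uf); ring.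
Qed.

Lemma vanishes_at_pi m (f : S) (v : nzvec R n) : f \is m.-homog ->
  vanishes_at f (\pi_Pn v) <-> f.@[coords v] = 0.
Proof.
move=> fm; split=> [|fv w /eqmodP/asboolP[c c0 wE]]; first by apply.
have -> : f.@[coords w] = f.@[fun i => c * val v 0 i].
  by apply: meval_eq => i; rewrite wE mxE.
by rewrite (dhomog_meval_scale _ _ fm) fv mulr0.
Qed.

Lemma vanishes_at_repr m (f : S) (p : Pn) : f \is m.-homog ->
  vanishes_at f p <-> f.@[coords (repr p)] = 0.
Proof. by move=> fm; rewrite -{1}[p]reprK; apply: vanishes_at_pi fm. Qed.

Lemma vanishes_at_mul k l (f g : S) (p : Pn) : f \is k.-homog -> g \is l.-homog ->
  vanishes_at (f * g) p <-> vanishes_at f p \/ vanishes_at g p.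
Proof.
move=> fk gl; rewrite (vanishes_at_repr _ fk) (vanishes_at_repr _ gl).
rewrite (vanishes_at_repr _ (dhomogM fk gl)) mevalM; split.
  by move/eqP; rewrite mulf_eq0 => /orP[] /eqP; [left|right].
by case=> ->; rewrite ?mulr0 ?mul0r.
Qed.

Definition ideal_of X : nat -> set S :=
  fun m f => f \is m.-homog /\ forall p, X p -> vanishes_at f p.

Definition zeros J : set Pn := [set p | forall m f, J m f -> vanishes_at f p].

Lemma gideal_ideal_of X : gideal (ideal_of X).
Proof.
split.
- by move=> m f [].
- by move=> m; split=> [|p _ v _]; [exact: dhomog0|exact: meval0].
- move=> m a f g [fm fX] [gm gX]; split; first by rewrite rpredD ?rpredZ.
  move=> p Xp v vp; rewrite mevalD mevalZ (fX p Xp v vp) (gX p Xp v vp).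
  by rewrite mulr0 addr0.
- move=> m k f g [fm fX] gk; split; first exact: dhomogM.
  by move=> p Xp v vp; rewrite mevalM (fX p Xp v vp) mulr0.
Qed.
Hint Resolve gideal_ideal_of : core.

Lemma ideal_ofS X Y : X `<=` Y -> gsub (ideal_of Y) (ideal_of X).
Proof. by move=> XY m f [fm fY]; split=> // p /XY/fY. Qed.

Lemma gsub_ideal_of_zeros J : gideal J -> gsub J (ideal_of (zeros J)).
Proof. by move=> gJ m f Jf; split=> [|p /(_ _ _ Jf)]; [exact: gideal_homog Jf|]. Qed.

Lemma hilbert_function_ideal_of X m : hilbert_function X m = hf (ideal_of X) m.
Proof.
rewrite /hilbert_function /hf; congr (_ - \dim _)%N; apply/esym/gpart_eq => f.
split=> [/ideal_partP fX|[_ fX]]; last exact/ideal_partP.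
by split=> //; exact: dhomog_is_dhomog.
Qed.

Lemma hilbert_poly_ideal_of X : hilbert_poly X = hp (ideal_of X).
Proof.
rewrite /hilbert_poly /hp /eventually_poly.
by have -> : hilbert_function X = hf (ideal_of X) by apply/funext => m; exact: hilbert_function_ideal_of.
Qed.

Lemma zariski_closed_zeros J : gideal J -> zariski_closed (zeros J).
Proof.
move=> gJ; exists [set f | exists m, J m f].
  by move=> f [m Jf]; exists m; apply: gideal_homog Jf.
apply/seteqP; split=> p /= Jp; first by move=> f [m]; apply: Jp.
by move=> m f Jf; apply: Jp; exists m.
Qed.

Lemma zeros_ideal_of X : zariski_closed X -> zeros (ideal_of X) = X.
Proof.
move=> [T Th XE]; apply/seteqP; split=> p; last by move=> Xp m f [_]; apply.
move=> Zp; rewrite XE => f Tf; have [m fm] := Th _ Tf; apply: (Zp m); split=> //.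
by move=> q; rewrite XE; apply.
Qed.

Lemma gsub_ideal_of_subset X Y : zariski_closed Y -> gsub (ideal_of Y) (ideal_of X) ->
  X `<=` Y.
Proof. by move=> cY IYX p Xp; rewrite -(zeros_ideal_of cY) => m f /IYX[_]; apply. Qed.

Lemma zariski_closed_cap X m f : zariski_closed X -> f \is m.-homog ->
  zariski_closed (X `&` [set p | vanishes_at f p]).
Proof.
move=> [T Th ->] fm; exists (T `|` [set f]).
  by move=> g [/Th//|->]; exists m.
apply/seteqP; split=> p /=; last by move=> H; split=> [g Tg|]; apply: H; [left|right].
by move=> [Tp fp] g [/Tp//|->].
Qed.

Lemma zariski_closedU X Y : zariski_closed X -> zariski_closed Y ->
  zariski_closed (X `|` Y).
Proof.
move=> [T Th ->] [U Uh ->]; exists [set h | exists f g, [/\ T f, U g & h = f * g]].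
  move=> h [f [g [/Th[k fk] /Uh[l gl] ->]]]; exists (k + l)%N; exact: dhomogM.
apply/seteqP; split=> p /=.
  move=> [H|H] h [f [g [Tf Ug ->]]]; have [k fk] := Th _ Tf; have [l gl] := Uh _ Ug;
    apply/(vanishes_at_mul _ fk gl); by [left; apply: H|right; apply: H].
move=> H; apply: contrapT => /not_orP[/existsNP[f /not_implyP[Tf nf]]].
move=> /existsNP[g /not_implyP[Ug ng]].
have [k fk] := Th _ Tf; have [l gl] := Uh _ Ug.
have : vanishes_at (f * g) p by apply: H; exists f, g.
by move=> /(vanishes_at_mul _ fk gl)[].
Qed.

Lemma zariski_closed0 : zariski_closed (set0 : set Pn).
Proof.
exists [set 1]; first by move=> _ ->; exists 0%N; exact: dhomog1.
apply/seteqP; split=> p //= /(_ 1 erefl).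
move=> /(vanishes_at_repr _ (dhomog1 _ _)); rewrite meval1 => /eqP.
by rewrite oner_eq0.
Qed.

Lemma irreducible_gprime X : irreducible_variety X -> gprime (ideal_of X).
Proof.
move=> [cX X0 Xirr]; split=> // k l a b ak bl [_ abX].
have [|||XE|XE] := Xirr (X `&` [set p | vanishes_at a p]) (X `&` [set p | vanishes_at b p]).
- exact: zariski_closed_cap ak.
- exact: zariski_closed_cap bl.
- apply/seteqP; split=> p; last by case=> -[].
  by move=> Xp; have /(vanishes_at_mul _ ak bl)[|] := abX p Xp; [left|right].
- by left; split=> // p; rewrite XE => -[].
- by right; split=> // p; rewrite XE => -[].
Qed.

Lemma nzvec_coord (v : nzvec R n) : exists i, val v 0 i != 0.
Proof.
apply: contrapT => /forallNP v0; have /eqP := valP v; apply; apply/rowP => i.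
by rewrite mxE; apply/eqP/negPn/negP/v0.
Qed.

Lemma varX_homog (i : 'I_n.+1) : ('X_i : S) \is 1.-homog.
Proof. by rewrite dhomogX; apply/eqP; exact: mdeg1. Qed.

Lemma varXn_homog (i : 'I_n.+1) m : ('X_i ^+ m : S) \is m.-homog.
Proof. by have := dhomogMn m (varX_homog i); rewrite mul1n. Qed.

(** A coordinate that is nonzero at a point of X has all its powers outside the ideal. *)
Lemma hp_ideal_of_neq0 X : X !=set0 -> hp (ideal_of X) != 0.
Proof.
move=> [p Xp]; apply/eqP => hp0.
have [N HN] := hpP (gideal_ideal_of X); have := HN N (leqnn _).
rewrite hp0 horner0 => /esym/eqP; rewrite pnatr_eq0 subn_eq0 => le.
have [i vi] := nzvec_coord (repr p).
have /gpartP : DHomog (varXn_homog i N) \in gpart (ideal_of X) N.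
  have /eqP -> : gpart (ideal_of X) N == fullv by rewrite eqEdim subvf.
  exact: memvf.
move=> /(_ (gideal_ideal_of _))[_ /(_ p Xp)].
move/(vanishes_at_repr _ (varXn_homog i N))/eqP.
by rewrite rmorphXn /= mevalXU expf_eq0 (negPf vi) andbF.
Qed.

(** The Nullstellensatz gives a zero of J off any form outside J. If the zero set were a proper
    union of Y and Z, forms outside J that vanish on Y and on Z would have their product in J. *)
Lemma gprime_zeros J : gprime J -> hp J != 0 ->
  irreducible_variety (zeros J) /\ ideal_of (zeros J) = J.
Proof.
move=> pJ hpJ; have [gJ _] := pJ.
have exi := exists_notin_var gJ hpJ.
have null m f : f \is m.-homog -> ~ J m f -> exists2 p, zeros J p & ~ vanishes_at f p.
  move=> fm nJf; have [x [[i xi] Jx fx]] :=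
    nullstellensatz (@complex_infinite_fibre R) pJ exi fm nJf.
  have v0 : (\row_i x i : 'rV[C]_n.+1) != 0.
    by apply: contraNneq xi => /rowP/(_ i); rewrite !mxE => ->.
  pose v : nzvec R n := Sub (\row_i x i : 'rV[C]_n.+1) v0.
  have vx g : g.@[coords v] = g.@[x] by apply: meval_eq => j; rewrite mxE.
  exists (\pi_Pn v).
    by move=> k g Jg; apply/(vanishes_at_pi v (gideal_homog gJ Jg)); rewrite vx (Jx k).
  by move/(vanishes_at_pi v fm); rewrite vx; apply/eqP.
have IJ : ideal_of (zeros J) = J.
  apply/funext => m; apply/seteqP; split=> f; last exact: gsub_ideal_of_zeros.
  move=> [fm fJ]; apply: contrapT => /(null _ _ fm)[p Jp]; apply; exact: fJ.
split=> //; split.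
- exact: zariski_closed_zeros.
- by have [i nJi] := exi; have [p Jp _] := null _ _ (varX_homog i) nJi; exists p.
- move=> Y Z cY cZ XE; apply: contrapT => /not_orP[XY XZ].
  have sep W : zariski_closed W -> W `<=` zeros J -> zeros J <> W ->
      exists k f, ideal_of W k f /\ ~ J k f.
    move=> cW WJ JW; apply: contrapT => /forallNP none; apply: JW.
    apply/seteqP; split=> //; apply: gsub_ideal_of_subset => // m f Wf.
    by rewrite IJ; apply: contrapT => nJf; apply: (none m); exists f.
  have [|k [f [[fk fY] nJf]]] := sep _ cY _ XY; first by rewrite XE; exact: subsetUl.
  have [|l [g [[gl gZ] nJg]]] := sep _ cZ _ XZ; first by rewrite XE; exact: subsetUr.
  case: (proj2 pJ _ _ _ _ fk gl) => //; rewrite -IJ; split; first exact: dhomogM.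
  by move=> p; rewrite XE => -[Yp|Zp]; apply/(vanishes_at_mul _ fk gl); [left; apply: fY|right; apply: gZ].
Qed.

Lemma size_hp_ideal_of_lt X Y : irreducible_variety Y -> zariski_closed X ->
  X `<` Y -> (size (hp (ideal_of X)) < size (hp (ideal_of Y)))%N.
Proof.
move=> iY cX [XY nYX].
have [e [a [Xa nYa]]] : exists e a, ideal_of X e a /\ ~ ideal_of Y e a.
  apply: contrapT => /forallNP none; apply: nYX.
  apply: gsub_ideal_of_subset => // m f Xf; apply: contrapT => nYf.
  by apply: (none m); exists f.
apply: (size_hp_lt (irreducible_gprime iY) _ (ideal_ofS XY) _ Xa nYa) => //.
  by case: Xa.
by apply: hp_ideal_of_neq0; case: iY.
Qed.

Lemma has_chain_size_hp X d : has_chain X d -> (d < size (hp (ideal_of X)))%N.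
Proof.
move=> [Z [Zirr Zlt]].
suff H i : (i <= d)%N -> (i < size (hp (ideal_of (Z i))))%N.
  apply: leq_trans (H d (leqnn d)) _; apply: size_hpS => //.
  by apply: ideal_ofS; case: (Zirr d (leqnn d)).
elim: i => [|i IH] id.
  rewrite size_poly_gt0 hp_ideal_of_neq0 //.
  by have [[_ ? _] _] := Zirr 0%N id.
apply: leq_ltn_trans (IH (ltnW id)) _.
apply: size_hp_ideal_of_lt; [by case: (Zirr _ id)| |exact: Zlt].
by have [[]] := Zirr i (ltnW id).
Qed.

(* By induction: a prime over I(X) + (x_i) whose Hilbert polynomial has degree at
   least one less gives the next variety of the chain. *)
Lemma exists_chain d X : irreducible_variety X -> (d < size (hp (ideal_of X)))%N ->
  exists Z : nat -> set Pn, [/\ forall i, (i <= d)%N -> irreducible_variety (Z i) /\ Z i `<=` X,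
    forall i, (i < d)%N -> Z i `<` Z i.+1 & Z d = X].
Proof.
elim: d X => [|d IH] X iX dX; first by exists (fun=> X); split=> // i _; split.
have [cX X0 _] := iX; have pX := irreducible_gprime iX.
have [i nXi] := exists_notin_var (gideal_ideal_of X) (hp_ideal_of_neq0 X0).
have gA := gideal_add (gideal_ideal_of X) (varX_homog i).
have [D sD] : exists D, size (hp (ideal_of X)) = D.+2.
  by case: (size _) dX => [|[|D]] //; exists D.
have sA := size_hp_add_ge pX (varX_homog i) (ltn0Sn 0) nXi sD.
have [|J [pJ AJ dJ]] := @exists_prime_size_hp _ _ _ d.+1 gA.
  by apply: leq_trans sA; rewrite -ltnS -sD.
have hpJ : hp J != 0 by rewrite -size_poly_gt0 (leq_trans _ dJ).
have [iY IY] := gprime_zeros pJ hpJ.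
have [|Z [Zirr Zlt Zd]] := IH _ iY; first by rewrite IY.
have YX : zeros J `<=` X.
  by apply: gsub_ideal_of_subset => //; rewrite IY => m f Xf; apply/AJ/gsub_add.
have YneX : zeros J `<` X.
  split=> // XY; apply: nXi; apply: (ideal_ofS XY); rewrite IY; apply: AJ.
  exact: gadd_mem.
exists (fun i => if (i <= d)%N then Z i else X); split.
- move=> j jd; case: ifP => [/Zirr[? ZY]|_]; last by split.
  by split=> //; apply: subset_trans YX.
- move=> k; rewrite ltnS => jd; rewrite jd.
  case: ltngtP jd => // [jd' _|-> _]; first exact: Zlt.
  by rewrite Zd.
- by rewrite ltnn.
Qed.

(** The size of the Hilbert polynomial drops strictly along a chain, which bounds its length, and
    [exists_chain] attains the bound. *)
Lemma krull_dim_size_hp X : irreducible_variety X ->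
  (krull_dim X).+1 = size (hp (ideal_of X)).
Proof.
move=> iX; have [_ X0 _] := iX.
have sX : (0 < size (hp (ideal_of X)))%N by rewrite size_poly_gt0 hp_ideal_of_neq0.
rewrite -(prednK sX); congr _.+1; set D := (size _).-1.
have chD : has_chain X D.
  have [|Z [Zirr Zlt _]] := @exists_chain D _ iX; first by rewrite /D prednK.
  by exists Z; split.
have maxD e : has_chain X e -> (e <= D)%N.
  by move=> /has_chain_size_hp; rewrite -{1}(prednK sX) ltnS.
rewrite /krull_dim; case: xgetP => [d _ [chd maxd]|/(_ D)].
  by apply/eqP; rewrite eqn_leq maxD // maxd.
by case; split.
Qed.

End Varieties.

(** * Hilbert polynomials of finite unions *)

Section Unions.
Variables (R : realType) (n : nat).
Local Notation C := R[i].
Local Notation Pn := (projspace R n).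
Local Notation S := {mpoly C[n.+1]}.
Implicit Types (X Y Z W : set Pn) (L : seq (set Pn)).
Hint Resolve gideal_ideal_of : core.

Lemma ideal_ofU X Y m f :
  ideal_of (X `|` Y) m f <-> ideal_of X m f /\ ideal_of Y m f.
Proof.
split=> [[fm fXY]|[[fm fX] [_ fY]]].
  by split; split=> // p ?; apply: fXY; [left|right].
by split=> // p [/fX|/fY].
Qed.

Lemma hf_ideal_ofU X Y m :
  (hf (ideal_of (X `|` Y)) m <= hf (ideal_of X) m + hf (ideal_of Y) m)%N.
Proof.
rewrite /hf; set U := gpart (ideal_of X) m; set V := gpart (ideal_of Y) m.
have -> : gpart (ideal_of (X `|` Y)) m = (U :&: V)%VS.
  apply: gpart_eq => f; rewrite memv_cap; split.
    by move=> /andP[/gpartP fU /gpartP fV]; apply/ideal_ofU; split; [apply: fU|apply: fV].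
  by move=> /ideal_ofU[fX fY]; apply/andP; split; apply/gpartP.
have := dimv_sum_cap U V; have := dimvS (subvf (U + V)%VS).
have := dimvS (subvf U); have := dimvS (subvf V).
move: (\dim _) (\dim _) (\dim _) (\dim _) (\dim _) => *; lia.
Qed.

Definition unions L : set Pn := \big[setU/set0]_(Z <- L) Z.

Lemma unions_cons Z L : unions (Z :: L) = Z `|` unions L.
Proof. exact: big_cons. Qed.

Lemma in_unions L p : unions L p <-> exists2 Z, Z \in L & Z p.
Proof.
elim: L => [|Z L IH].
  by rewrite /unions big_nil; split=> // -[].
rewrite unions_cons; split=> [[Zp|/IH[W WL Wp]]|[W]].
- by exists Z => //; rewrite mem_head.
- by exists W => //; rewrite inE WL orbT.
- by rewrite inE => /orP[/eqP->|WL Wp]; [left|right; apply/IH; exists W].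
Qed.

Lemma zariski_closed_unions L :
  (forall Z, Z \in L -> zariski_closed Z) -> zariski_closed (unions L).
Proof.
elim: L => [|Z L IH] cL; first by rewrite /unions big_nil; exact: zariski_closed0.
rewrite unions_cons; apply: zariski_closedU; first by apply: cL; rewrite mem_head.
by apply: IH => W WL; apply: cL; rewrite inE WL orbT.
Qed.

Lemma hf_unions_le L m :
  (hf (ideal_of (unions L)) m <= \sum_(Z <- L) hf (ideal_of Z) m)%N.
Proof.
elim: L => [|Z L IH].
  rewrite /unions !big_nil leqn0 subn_eq0; apply/dimvS/subvP => f _.
  by apply/gpartP => //; split=> //; exact: dhomog_is_dhomog.
rewrite unions_cons big_cons; apply: leq_trans (hf_ideal_ofU _ _ _) _.
by rewrite leq_add2l.
Qed.

Lemma notin_ideal_of_varX X : X !=set0 -> gprime (ideal_of X) ->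
  exists i, forall k, ~ ideal_of X k ('X_i ^+ k).
Proof.
move=> X0 [gX pX]; have [i nXi] := exists_notin_var gX (hp_ideal_of_neq0 X0).
exists i; elim=> [|k IH]; last first.
  by rewrite exprS -add1n => /pX[||//|//]; [exact: varX_homog|exact: varXn_homog].
move=> X1; apply: nXi; rewrite -[1%N]addn0 -['X_i]mulr1.
by apply: gidealMl => //; exact: varX_homog.
Qed.

(** Multiplication by the k-th power of a variable outside the prime is injective on the
    quotient. *)
Lemma hf_ideal_of_mono X m k : X !=set0 -> gprime (ideal_of X) ->
  (hf (ideal_of X) m <= hf (ideal_of X) (k + m))%N.
Proof.
move=> X0 pX; have [i nXi] := notin_ideal_of_varX X0 pX.
have gA := gideal_add (gideal_ideal_of X) (varXn_homog R i k).
have := hf_colon_le m (gideal_ideal_of X) gA (varXn_homog R i k) (@gsub_add _ _ _ _ _)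
  (gadd_mem _ _ (gideal_ideal_of X)).
rewrite (hf_colon_prime _ pX (varXn_homog R i k)) //.
by apply: leq_trans; rewrite leq_addl.
Qed.

(** The product of forms taken from the ideal of each member of [L] but outside the ideal of W stays
    outside it by primality. *)
Lemma ideal_of_separate L W : W !=set0 -> gprime (ideal_of W) ->
    (forall Z, Z \in L -> ~ gsub (ideal_of Z) (ideal_of W)) ->
  exists e a, ideal_of (unions L) e a /\ ~ ideal_of W e a.
Proof.
move=> W0 pW; have [i nWi] := notin_ideal_of_varX W0 pW.
elim: L => [|Z L IH] nL.
  exists 0%N, 1; split; last by have := nWi 0%N; rewrite expr0.
  by rewrite /unions big_nil; split=> //; exact: dhomog1.
have [Y YL|e [a [aL nWa]]] := IH; first by apply: nL; rewrite inE YL orbT.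
have [k [b [bZ nWb]]] : exists k b, ideal_of Z k b /\ ~ ideal_of W k b.
  apply: contrapT => /forallNP none; apply: (nL Z (mem_head _ _)) => m f Zf.
  by apply: contrapT => nWf; apply: (none m); exists f.
exists (k + e)%N, (b * a); rewrite unions_cons; split.
  apply/ideal_ofU; split; first by apply: gidealMr => //; case: aL.
  by apply: gidealMl => //; case: bZ.
by move=> /(proj2 pW)[|||]//; [case: bZ|case: aL].
Qed.

(** Let [a] of degree e vanish on the other members but not on Z. Then the ideal of the whole union,
    colon [a], lies in the ideal of Z, and the exact sequence adds the count of Z to that of the
    rest. [E] is the total degree of the separating forms. *)
Lemma hf_unions_ge L : uniq L ->
    (forall Z, Z \in L -> Z !=set0 /\ gprime (ideal_of Z)) ->
    (forall Z W, Z \in L -> W \in L -> gsub (ideal_of Z) (ideal_of W) -> Z = W) ->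
  exists E, forall m k, (E <= k)%N ->
    (\sum_(Z <- L) hf (ideal_of Z) m <= hf (ideal_of (unions L)) (k + m))%N.
Proof.
elim: L => [|Z L IH] /=; first by exists 0%N => m k _; rewrite big_nil.
move=> /andP[ZL uL] pL sL.
have [||E HE] := IH uL.
- by move=> W WL; apply: pL; rewrite inE WL orbT.
- by move=> V W VL WL; apply: sL; rewrite inE ?VL ?WL orbT.
have [Z0 pZ] := pL Z (mem_head _ _).
have [|e [a [aL nZa]]] := ideal_of_separate (L := L) Z0 pZ.
  move=> W WL /sL WZ; move: ZL; rewrite -WZ ?WL ?inE ?eqxx //.
  by rewrite WL orbT.
have ae : a \is e.-homog by case: aL.
exists (e + E)%N => m k Ek; have [l kE] : exists l, k = (e + l)%N.
  by exists (k - e)%N; rewrite subnKC // (leq_trans _ Ek) // leq_addr.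
rewrite kE leq_add2l in Ek; rewrite big_cons unions_cons kE -addnA.
have gZL := gideal_ideal_of (Z `|` unions L).
have leA := hf_colon_le (l + m) gZL (gideal_ideal_of (unions L)) ae (ideal_ofS (@subsetUr _ _ _)) aL.
rewrite addnC; apply: leq_trans leA; apply: leq_add.
  by rewrite addnA; apply: HE; apply: leq_trans Ek (leq_addl _ _).
apply: leq_trans (hf_ideal_of_mono m l Z0 pZ) _.
apply: hfS => //; first exact: gideal_colon.
move=> j f [fj /ideal_ofU[Zaf _]].
by case: (proj2 pZ _ _ _ _ ae fj Zaf).
Qed.

Lemma hp_unions X L : uniq L -> X !=set0 -> L != [::] ->
    (forall Z, Z \in L -> [/\ Z !=set0, gprime (ideal_of Z) & hf (ideal_of Z) =1 hf (ideal_of X)]) ->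
    (forall Z W, Z \in L -> W \in L -> gsub (ideal_of Z) (ideal_of W) -> Z = W) ->
  size (hp (ideal_of (unions L))) = size (hp (ideal_of X)) /\
  lead_coef (hp (ideal_of (unions L))) = (size L)%:R * lead_coef (hp (ideal_of X)).
Proof.
move=> uL X0 L0 pL sL; set P := hp (ideal_of X); set Q := hp _; set N := size L.
have N0 : N%:R != 0 :> rat by rewrite pnatr_eq0 size_eq0.
have sumE m : (\sum_(Z <- L) hf (ideal_of Z) m = N * hf (ideal_of X) m)%N.
  rewrite big_seq (eq_bigr (fun=> hf (ideal_of X) m)); last by move=> Z /pL[_ _ ->].
  by rewrite -big_seq big_const_seq count_predT iter_addn addn0 mulnC.
have [M HM] := hpP (gideal_ideal_of X).
have HQ := hpP (gideal_ideal_of (unions L)); rewrite -/Q in HQ.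
have NPev : eventually_poly (fun m => N * hf (ideal_of X) m)%N (N%:R *: P).
  by exists M => m Mm; rewrite hornerZ HM // natrM.
have [|E HE] := hf_unions_ge uL _ sL; first by move=> Z /pL[].
have [|le1 lc1] := eventually_poly_le HQ NPev.
  by exists 0%N => m _; rewrite -sumE hf_unions_le.
have [|le2 lc2] := eventually_poly_le NPev (eventually_poly_shiftD E HQ).
  by exists 0%N => m _; rewrite -sumE addnC HE.
rewrite size_shift size_scale // in le1 le2 lc1 lc2.
have sE : size Q = size P by apply/eqP; rewrite eqn_leq le1 le2.
split=> //; apply: le_anti; rewrite -lead_coefZ lc1 //=.
by rewrite -(lead_coef_shift E%:R Q) lc2.
Qed.

End Unions.

(** * The action of the roots of unity *)

Lemma prim_root_exists (F : numClosedFieldType) k : (0 < k)%N ->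
  exists z : F, k.-primitive_root z.
Proof.
pose p : {poly F} := 'X^k - 1; have [s Dp] := closed_field_poly_normal p.
move=> k0; rewrite (monicP _) ?monicXnsubC // scale1r in Dp.
have sk1 : all k.-unity_root s by apply/allP => z; rewrite -root_prod_XsubC -Dp.
have sz_s : (k < (size s).+1)%N.
  by rewrite -(size_prod_XsubC s id) -Dp size_XnsubC.
have [|z] := hasP (has_prim_root k0 sk1 _ sz_s); last by exists z.
by rewrite -separable_prod_XsubC -Dp separable_Xn_sub_1 // pnatr_eq0 -lt0n.
Qed.

Section Torus.
Variables (R : realType) (n r' : nat).
Local Notation r := r'.+1.
Local Notation C := R[i].
Local Notation Pn := (projspace R n).
Local Notation S := {mpoly C[n.+1]}.
Local Notation coords v := (fun i => val v 0 i).
Local Notation T := {ffun 'I_n.+1 -> 'I_r}.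
Local Notation G := (Ggroup R n r).
Variables (z : C) (zP : r.-primitive_root z).
Implicit Types (X Y Z : set Pn) (J K : nat -> set S) (a b : T).

Lemma z_neq0 : z != 0.
Proof.
have := prim_expr_order zP; case: eqVneq => [->|//].
by rewrite expr0n /= => /eqP; rewrite eq_sym oner_eq0.
Qed.

Lemma zX_unity k : (z ^+ k != 0) && ((z ^+ k) ^+ r == 1).
Proof. by rewrite expf_neq0 ?z_neq0 // exprAC (prim_expr_order zP) expr1n eqxx. Qed.

Lemma zXD (j k : 'I_r) : z ^+ (j + k)%R = z ^+ j * z ^+ k.
Proof. by rewrite /= (prim_expr_mod zP) exprD. Qed.

Lemma zX_inj (j k : 'I_r) : z ^+ j = z ^+ k -> j = k.
Proof.
move=> /eqP; rewrite (eq_prim_root_expr zP) !modn_small // => /eqP; exact: val_inj.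
Qed.

(** Exponents of a primitive root turn the tuples into the additive group (Z/r)^(n+1), so that
    orbits and cosets can be handled before passing to the quotient set [Ggroup]. *)
Definition root_exp a : root_tuple R n r :=
  [ffun i => Sub (z ^+ a i) (zX_unity (a i))].

Lemma val_root_exp a i : val (root_exp a i) = z ^+ a i.
Proof. by rewrite ffunE. Qed.

Definition actp a (p : Pn) : Pn := gact (\pi_G (root_exp a)) p.

Lemma actp_pi a v : actp a (\pi_Pn v) = \pi_Pn (nzvec_scale (root_exp a) v).
Proof. exact: gact_pi. Qed.

Lemma coords_scale a v i : val (nzvec_scale (root_exp a) v) 0 i = z ^+ a i * val v 0 i.
Proof. by rewrite mxE val_root_exp. Qed.

Lemma actpD a b p : actp (a + b) p = actp a (actp b p).
Proof.
rewrite -[p]reprK (actp_pi b (repr p)) (actp_pi a) (actp_pi (a + b)).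
congr (\pi_Pn _); apply/val_inj/rowP => i.
by rewrite !coords_scale ffunE zXD mulrA.
Qed.

Lemma actp0 p : actp 0 p = p.
Proof.
rewrite -[p]reprK !actp_pi; congr (\pi_Pn _); apply/val_inj/rowP => i.
by rewrite !coords_scale ffunE mul1r.
Qed.

Definition acts a X : set Pn := actp a @` X.

Lemma actsD a b X : acts (a + b) X = acts a (acts b X).
Proof. by rewrite /acts image_comp; apply: eq_imagel => p _; exact: actpD. Qed.

Lemma acts0 X : acts 0 X = X.
Proof. by rewrite -[RHS]image_id; apply: eq_imagel => p _; exact: actp0. Qed.

Lemma actNs a X : acts (- a) (acts a X) = X.
Proof. by rewrite -actsD addNr acts0. Qed.

Lemma vanishes_actp m (f : S) a v : f \is m.-homog ->
  vanishes_at f (actp a (\pi_Pn v)) <-> f.@[fun i => z ^+ a i * val v 0 i] = 0.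
Proof.
move=> fm; rewrite actp_pi (vanishes_at_pi _ fm).
suff -> : f.@[coords (nzvec_scale (root_exp a) v)] = f.@[fun i => z ^+ a i * val v 0 i] by [].
by apply: meval_eq => i; rewrite coords_scale.
Qed.

(** The pullback of [f] along the action of [a]. *)
Definition twist a (f : S) : S := f \mPo [tuple z ^+ a i *: 'X_i | i < n.+1].

Lemma meval_twist a f x : (twist a f).@[x] = f.@[fun i => z ^+ a i * x i].
Proof.
rewrite comp_mpoly_meval; apply: meval_eq => i.
by rewrite tnth_mktuple mevalZ mevalXU.
Qed.

Lemma twistE a f :
  twist a f = \sum_(u <- msupp f) (f@_u * \prod_i (z ^+ a i) ^+ u i) *: 'X_[u].
Proof.
rewrite /twist comp_mpolyE; apply: eq_bigr => u _; rewrite -scalerA; congr (_ *: _).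
under [LHS]eq_bigr do rewrite tnth_mktuple exprZn.
by rewrite scaler_prod -mpolyXE_id.
Qed.

Lemma mcoeff_sumX (s : seq 'X_{1..n.+1}) (c : 'X_{1..n.+1} -> C) u : uniq s ->
  (\sum_(v <- s) c v *: 'X_[v])@_u = if u \in s then c u else 0.
Proof.
move=> us; rewrite raddf_sum /=; case: ifPn => su.
  rewrite (bigD1_seq u) //= mcoeffZ mcoeffX eqxx mulr1 big1 ?addr0 // => v vu.
  by rewrite mcoeffZ mcoeffX (negPf vu) mulr0.
rewrite big_seq big1 // => v sv; rewrite mcoeffZ mcoeffX.
by case: eqP => [e|]; rewrite ?mulr0 //; rewrite -e sv in su.
Qed.

Lemma mcoeff_twist a f u : (twist a f)@_u = f@_u * \prod_i (z ^+ a i) ^+ u i.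
Proof.
rewrite twistE mcoeff_sumX ?msupp_uniq //; case: ifPn => // /memN_msupp_eq0 ->.
by rewrite mul0r.
Qed.

Lemma msupp_twist a f : msupp (twist a f) =i msupp f.
Proof.
move=> u; rewrite !mcoeff_msupp mcoeff_twist mulf_eq0 negb_or andbC.
rewrite (_ : _ != 0) //; apply/prodf_neq0 => i _; by rewrite !expf_neq0 ?z_neq0.
Qed.

Lemma eq_msupp_mlead (f g : S) : msupp f =i msupp g -> mlead f = mlead g.
Proof. by move=> fg; apply: perm_big; apply: uniq_perm; rewrite ?msupp_uniq. Qed.

Lemma eq_msupp_neq0 (f g : S) : msupp f =i msupp g -> (f == 0) = (g == 0).
Proof.
move=> fg; rewrite -!msupp_eq0.
have /perm_size : perm_eq (msupp f) (msupp g) by apply: uniq_perm; rewrite ?msupp_uniq.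
by case: (msupp f) => [|? ?]; case: (msupp g).
Qed.

Lemma eq_msupp_homog (f g : S) m : msupp f =i msupp g -> f \is m.-homog -> g \is m.-homog.
Proof. by move=> fg /dhomogP fm; apply/dhomogP => u; rewrite -fg; exact: fm. Qed.

Lemma twist_homog a f m : f \is m.-homog -> twist a f \is m.-homog.
Proof. by apply: eq_msupp_homog => u; rewrite msupp_twist. Qed.

Lemma ideal_of_acts a X m f : ideal_of (acts a X) m f <-> ideal_of X m (twist a f).
Proof.
split=> -[fm fX].
  split=> [|p Xp]; first exact: twist_homog.
  apply/(vanishes_at_repr _ (twist_homog a fm)); rewrite meval_twist.
  by apply/(vanishes_actp _ _ fm); rewrite reprK; apply: fX; exists p.
have {}fm : f \is m.-homog by apply: eq_msupp_homog fm => u; rewrite msupp_twist.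
split=> // _ [p Xp <-]; rewrite -[p]reprK; apply/(vanishes_actp _ _ fm).
by rewrite -meval_twist; apply/(vanishes_at_repr _ (twist_homog a fm)); exact: fX.
Qed.

Lemma glead_acts_sub a X u : glead (ideal_of (acts a X)) u -> glead (ideal_of X) u.
Proof.
move=> /asboolP[f [/ideal_of_acts fX f0 fu]]; apply/asboolP; exists (twist a f).
split=> //; first by rewrite (eq_msupp_neq0 (msupp_twist a f)).
by rewrite (eq_msupp_mlead (msupp_twist a f)).
Qed.

(** Pullback multiplies each coefficient by a root of unity, so supports and leading monomials are
    unchanged. *)
Lemma hf_acts a X m : hf (ideal_of (acts a X)) m = hf (ideal_of X) m.
Proof.
rewrite !hf_monos; [|exact: gideal_ideal_of..].
apply: eq_count => s /=; congr (~~ _); apply/idP/idP; first exact: glead_acts_sub.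
by rewrite -{1}(actNs a X); apply: glead_acts_sub.
Qed.

Lemma gprime_acts a X : gprime (ideal_of X) -> gprime (ideal_of (acts a X)).
Proof.
move=> [_ pX]; split=> [|k l f g fk gl /ideal_of_acts]; first exact: gideal_ideal_of.
rewrite /twist rmorphM => /pX[||H|H]; [exact: twist_homog|exact: twist_homog| |].
  by left; apply/ideal_of_acts.
by right; apply/ideal_of_acts.
Qed.

Lemma zariski_closed_acts a X : zariski_closed X -> zariski_closed (acts a X).
Proof.
move=> cX; have <- : zeros (ideal_of (acts a X)) = acts a X.
  apply/seteqP; split=> p; last by move=> aXp m f [_]; apply.
  move=> Zp; exists (actp (- a) p); last by rewrite -actpD subrr actp0.
  rewrite -(zeros_ideal_of cX) => m f [fm fX].
  rewrite -[p]reprK; apply/(vanishes_actp _ _ fm); rewrite -meval_twist.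
  apply/(vanishes_at_repr _ (twist_homog _ fm)); apply: (Zp m).
  by apply/(ideal_of_acts (- a) (acts a X)); rewrite actNs; split.
exact/zariski_closed_zeros/gideal_ideal_of.
Qed.

End Torus.

(** * Coordinate-wise powers *)

Section CoordinatePower.
Variables (R : realType) (n r' : nat).
Local Notation r := r'.+1.
Local Notation C := R[i].
Local Notation Pn := (projspace R n).
Local Notation S := {mpoly C[n.+1]}.
Local Notation coords v := (fun i => val v 0 i).
Local Notation T := {ffun 'I_n.+1 -> 'I_r}.
Local Notation G := (Ggroup R n r).
Implicit Types (X Y Z : set Pn) (J K : nat -> set S) (a b : T).
Hint Resolve gideal_ideal_of : core.

Definition pow (h : S) : S := h \mPo [tuple 'X_i ^+ r | i < n.+1].

Lemma meval_pow h x : (pow h).@[x] = h.@[fun i => x i ^+ r].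
Proof.
rewrite comp_mpoly_meval; apply: meval_eq => i.
by rewrite tnth_mktuple rmorphXn /= mevalXU.
Qed.

Lemma powX u : pow 'X_[u] = 'X_[u *+ r].
Proof.
rewrite /pow comp_mpolyX [RHS]mpolyXE_id; apply: eq_bigr => i _.
by rewrite tnth_mktuple -exprM mulmnE mulnC.
Qed.

Lemma powE h : pow h = \sum_(v <- msupp h) h@_v *: 'X_[v *+ r].
Proof. by rewrite /pow comp_mpolyE; apply: eq_bigr => v _; rewrite -powX /pow comp_mpolyX. Qed.

Lemma mulmn_inj : injective (fun u : 'X_{1..n.+1} => u *+ r)%MM.
Proof.
move=> u v /mnmP uv; apply/mnmP => i; have := uv i; rewrite !mulmnE => /eqP.
by rewrite eqn_pmul2r // => /eqP.
Qed.

Lemma mcoeff_pow h v : (pow h)@_(v *+ r) = h@_v.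
Proof.
rewrite powE [in RHS](mpolyE h) !raddf_sum /=; apply: eq_bigr => u _.
by rewrite !mcoeffZ !mcoeffX (inj_eq mulmn_inj).
Qed.

Lemma msupp_pow h u : u \in msupp (pow h) -> exists2 v, v \in msupp h & u = (v *+ r)%MM.
Proof.
rewrite powE => /msupp_sum_le /flattenP[t /mapP[v + ->]].
rewrite mem_filter /= => vh /msuppZ_le; rewrite msuppX inE => /eqP ->.
by exists v.
Qed.

Lemma pow_neq0 h : h != 0 -> pow h != 0.
Proof.
move=> h0; have := mlead_supp h0; rewrite mcoeff_msupp -mcoeff_pow.
by apply: contraNneq => ->; rewrite mcoeff0.
Qed.

Lemma lem_mulmn (u v : 'X_{1..n.+1}) k : (u <= v)%O -> ((u *+ k)%MM <= (v *+ k)%MM)%O.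
Proof.
by move=> uv; elim: k => [|k IH]; rewrite ?mulm0n // !mulmS; apply: lem_add.
Qed.

Lemma mlead_pow h : h != 0 -> mlead (pow h) = (mlead h *+ r)%MM.
Proof.
move=> h0; apply: le_anti; apply/andP; split.
  have [v vh ->] := msupp_pow (mlead_supp (pow_neq0 h0)).
  exact/lem_mulmn/msupp_le_mlead.
apply: msupp_le_mlead; rewrite mcoeff_msupp mcoeff_pow -mcoeff_msupp.
exact: mlead_supp.
Qed.

Lemma pow_homog h m : (pow h \is (m * r)%N.-homog) = (h \is m.-homog).
Proof.
apply/idP/idP => /dhomogP hm; apply/dhomogP => u.
  rewrite mcoeff_msupp -mcoeff_pow -mcoeff_msupp => /hm/eqP /=.
  by rewrite mdegMn eqn_pmul2r // => /eqP.
by move=> /msupp_pow[v /hm /= vm ->]; rewrite mdegMn vm.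
Qed.

Lemma phi_coords (v : nzvec R n) i : val (nzvec_pow r v) 0 i = val v 0 i ^+ r.
Proof. by rewrite mxE. Qed.

Lemma vanishes_at_phi m h p : h \is m.-homog ->
  vanishes_at h (phi r p) <-> vanishes_at (pow h) p.
Proof.
move=> hm; have phm : pow h \is (m * r)%N.-homog by rewrite pow_homog.
rewrite -{1}[p]reprK phi_pi (vanishes_at_pi _ hm) (vanishes_at_repr _ phm) meval_pow.
suff -> : h.@[coords (nzvec_pow r (repr p))] = h.@[fun i => val (repr p) 0 i ^+ r] by [].
by apply: meval_eq => i; rewrite phi_coords.
Qed.

Lemma ideal_of_coord_power X m h :
  ideal_of (coord_power r X) m h <-> ideal_of X (m * r)%N (pow h).
Proof.
split=> -[hm hX].
  split=> [|p Xp]; first by rewrite pow_homog.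
  by apply/(vanishes_at_phi _ hm)/hX; exists p.
rewrite pow_homog in hm; split=> // _ [p Xp <-].
by apply/(vanishes_at_phi _ hm)/hX.
Qed.

Lemma gprime_coord_power X : gprime (ideal_of X) -> gprime (ideal_of (coord_power r X)).
Proof.
move=> [_ pX]; split=> // k l f g fk gl /ideal_of_coord_power.
rewrite mulnDl /pow rmorphM => /pX[||H|H]; [by rewrite pow_homog|by rewrite pow_homog| |].
  by left; apply/ideal_of_coord_power.
by right; apply/ideal_of_coord_power.
Qed.

Definition mnm_class (u : 'X_{1..n.+1}) : T := [ffun i => inZp (u i)].
Definition mnm_rem a : 'X_{1..n.+1} := [multinom (a i : nat) | i < n.+1].
Definition mnm_div (u : 'X_{1..n.+1}) : 'X_{1..n.+1} := [multinom u i %/ r | i < n.+1].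

Lemma mnm_divn_eq u : u = (mnm_rem (mnm_class u) + mnm_div u *+ r)%MM.
Proof.
apply/mnmP => i; rewrite mnmDE mulmnE !mnmE ffunE /= addnC; exact: divn_eq.
Qed.

Lemma mnm_class_eq a u v : u = (mnm_rem a + v *+ r)%MM -> mnm_class u = a /\ mnm_div u = v.
Proof.
move=> ->; split; [apply/ffunP => i; apply: val_inj|apply/mnmP => i].
  by rewrite ffunE /= mnmDE mulmnE mnmE addnC modnMDl modn_small.
by rewrite !mnmE mulmnE addnC divnMDl // divn_small ?addn0.
Qed.

(** The component of [f] on which the group acts by the character with exponents [a]; [class_root]
    below is the h of its factorisation x^a h(x^r). *)
Definition class_part a (f : S) : S :=
  \sum_(u <- msupp f | mnm_class u == a) f@_u *: 'X_[u].
Definition class_root a (f : S) : S :=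
  \sum_(u <- msupp f | mnm_class u == a) f@_u *: 'X_[mnm_div u].

Lemma class_partE a f : class_part a f = 'X_[mnm_rem a] * pow (class_root a f).
Proof.
rewrite /pow raddf_sum mulr_sumr; apply: eq_bigr => u /eqP <-.
by rewrite /= comp_mpolyZ -/(pow _) powX -scalerAr -mpolyXD -mnm_divn_eq.
Qed.

Lemma sum_class_part f : f = \sum_a class_part a f.
Proof.
rewrite {1}(mpolyE f) (exchange_big_dep xpredT) //=; apply: eq_bigr => u _.
by rewrite (eq_bigl (pred1 (mnm_class u))) ?big_pred1_eq.
Qed.

Lemma mcoeff_class_part a f u :
  (class_part a f)@_u = if mnm_class u == a then f@_u else 0.
Proof.
rewrite /class_part -big_filter mcoeff_sumX ?filter_uniq ?msupp_uniq // mem_filter.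
case: eqP => //= _; case: ifPn => // /memN_msupp_eq0 //.
Qed.

Lemma class_part_homog a f m : f \is m.-homog -> class_part a f \is m.-homog.
Proof.
move=> /dhomogP fm; apply/dhomogP => u; rewrite mcoeff_msupp mcoeff_class_part.
by case: ifP => [_|]; rewrite ?eqxx // -mcoeff_msupp; exact: fm.
Qed.

Variables (z : C) (zP : r.-primitive_root z).
Local Notation actp := (actp zP).
Local Notation acts := (acts zP).

Lemma sum_root_of_unity (y : C) : y ^+ r = 1 -> \sum_(j < r) y ^+ j = if y == 1 then r%:R else 0.
Proof.
move=> yr; case: eqP => [->|/eqP y1].
  by under eq_bigr do rewrite expr1n; rewrite sumr_const card_ord.
apply/eqP; have /eqP := subrX1 y r; rewrite yr subrr eq_sym mulf_eq0 subr_eq0.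
by rewrite (negPf y1).
Qed.

(** Projection to an isotypic component by averaging over the group, whose order is r^(n+1), against
    the inverse character. *)
Lemma meval_class_part a f x :
  (r ^ n.+1)%:R * (class_part a f).@[x] =
  \sum_(b : T) (\prod_i (z ^+ b i) ^+ a i)^-1 * f.@[fun i => z ^+ b i * x i].
Proof.
have chi (u : 'X_{1..n.+1}) : \sum_(b : T) (\prod_i (z ^+ b i) ^+ a i)^-1 * \prod_i (z ^+ b i) ^+ u i =
    if mnm_class u == a then (r ^ n.+1)%:R else 0.
  have z0 := z_neq0 zP.
  transitivity (\sum_(b : T) \prod_i (z ^+ u i / z ^+ a i) ^+ b i).
    apply: eq_bigr => b _; rewrite -prodfV -big_split; apply: eq_bigr => i _ /=.
    by rewrite exprMn exprVn -!exprM mulrC ![(b i * _)%N]mulnC.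
  (* Orthogonality of characters: the sum over the group is a product of geometric sums, one per
     coordinate. *)
  rewrite -(bigA_distr_bigA (fun i (j : 'I_r) => (z ^+ u i / z ^+ a i) ^+ j)).
  transitivity (\prod_i (if inZp (u i) == a i then r%:R else 0 : C)).
    apply: eq_bigr => i _; rewrite sum_root_of_unity; last first.
      by rewrite exprMn exprVn -!exprM ![(_ * r)%N]mulnC !exprM (prim_expr_order zP) !expr1n divr1.
    congr (if _ then _ else _); rewrite -subr_eq0 -(inj_eq (mulIf (expf_neq0 (a i) z0))).
    rewrite mul0r mulrBl mul1r divfK ?expf_neq0 // subr_eq0 (eq_prim_root_expr zP).
    by rewrite -val_eqE /= [X in _ == X]modn_small.
  case: eqP => [<-|ne].
    rewrite (eq_bigr (fun=> r%:R)) => [|i _]; last by rewrite ffunE eqxx.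
    by rewrite prodr_const card_ord natrX.
  have /existsP[i ui] : [exists i, inZp (u i) != a i].
    apply: contra_notT ne; rewrite negb_exists => /forallP ua.
    by apply/ffunP => i; rewrite ffunE; apply/eqP; have := ua i; rewrite negbK.
  by rewrite (bigD1 i) //= (negPf ui) mul0r.
under [RHS]eq_bigr do rewrite mevalE mulr_sumr.
rewrite exchange_big /= raddf_sum mulr_sumr big_mkcond /=; apply: eq_bigr => u _.
rewrite mevalZ mevalX.
transitivity (f@_u * \prod_i x i ^+ u i *
    \sum_(b : T) (\prod_i (z ^+ b i) ^+ a i)^-1 * \prod_i (z ^+ b i) ^+ u i).
  by rewrite chi; case: eqP => _; ring.
rewrite mulr_sumr; apply: eq_bigr => b _.
have -> : \prod_i (z ^+ b i * x i) ^+ u i = (\prod_i (z ^+ b i) ^+ u i) * \prod_i x i ^+ u i.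
  by rewrite -big_split; apply: eq_bigr => i _; rewrite exprMn.
ring.
Qed.

Definition orbit_sets X : seq (set Pn) := undup [seq acts a X | a : T].
Definition orbit_union X : set Pn := unions (orbit_sets X).

Lemma in_orbit_union X p : orbit_union X p <-> exists a, acts a X p.
Proof.
rewrite /orbit_union in_unions; split=> [[Z]|[a aXp]].
  by rewrite mem_undup => /mapP[a _ ->] ?; exists a.
by exists (acts a X) => //; rewrite mem_undup; apply: map_f; rewrite mem_enum.
Qed.

Lemma ideal_of_orbit X m f : ideal_of (orbit_union X) m f <->
  f \is m.-homog /\ forall a p, X p -> f.@[fun i => z ^+ a i * val (repr p) 0 i] = 0.
Proof.
split=> -[fm fX]; split=> //.
  move=> a p Xp; apply/(vanishes_actp zP a (repr p) fm); rewrite reprK.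
  by apply: fX; apply/in_orbit_union; exists a, p.
move=> _ /in_orbit_union[a [p Xp <-]]; rewrite -[p]reprK.
by apply/(vanishes_actp zP a (repr p) fm)/fX.
Qed.

Lemma orbit_unionS X : X `<=` orbit_union X.
Proof. by move=> p Xp; apply/in_orbit_union; exists 0; rewrite acts0. Qed.

(** By the averaging formula, a value of the component on the orbit is a combination of values of
    [f] on the orbit. *)
Lemma ideal_of_orbit_class_part X m a f :
  ideal_of (orbit_union X) m f -> ideal_of (orbit_union X) m (class_part a f).
Proof.
move=> /ideal_of_orbit[fm fX]; apply/ideal_of_orbit; split=> [|b p Xp].
  exact: class_part_homog.
have rn : (r ^ n.+1)%:R != 0 :> C by rewrite pnatr_eq0 expn_eq0.
apply: (mulfI rn); rewrite mulr0 meval_class_part big1 // => c _.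
rewrite (_ : meval _ _ = 0) ?mulr0 // -[RHS](fX (c + b) p Xp).
by apply: meval_eq => i; rewrite ffunE zXD // mulrA.
Qed.

Lemma ideal_of_orbit_pow X m h :
  ideal_of (orbit_union X) (m * r)%N (pow h) <-> ideal_of (coord_power r X) m h.
Proof.
rewrite ideal_of_coord_power; split; first exact: ideal_ofS (@orbit_unionS X) _ _.
move=> [hm hX]; apply/ideal_of_orbit; split=> // a p /hX /(vanishes_at_repr _ hm).
rewrite !meval_pow => hp0; rewrite -[RHS]hp0; apply: meval_eq => i.
by rewrite exprMn exprAC (prim_expr_order zP) expr1n mul1r.
Qed.

Lemma zariski_closed_orbit X : zariski_closed X -> zariski_closed (orbit_union X).
Proof.
move=> cX; apply: zariski_closed_unions => Z; rewrite mem_undup => /mapP[a _ ->].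
exact: zariski_closed_acts.
Qed.

Lemma nth_root_exists (c : C) : exists d, d ^+ r = c.
Proof. by exists (r.-root c); rewrite rootCK. Qed.

Lemma phi_surj (p : Pn) : exists q, phi r q = p.
Proof.
have [d dP] := choice nth_root_exists.
have v0 : (\row_i d (val (repr p) 0 i) : 'rV[C]_n.+1) != 0.
  have [i pi] := nzvec_coord (repr p); apply: contraNneq pi => /rowP/(_ i).
  by rewrite !mxE => di; rewrite -(dP (val (repr p) 0 i)) di expr0n.
exists (\pi_Pn (Sub (\row_i d (val (repr p) 0 i)) v0 : nzvec R n)).
rewrite phi_pi -[RHS]reprK; congr (\pi_Pn _); apply/val_inj/rowP => i.
by rewrite phi_coords mxE dP.
Qed.

Lemma phi_actp a p : phi r (actp a p) = phi r p.
Proof.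
rewrite -[p]reprK actp_pi !phi_pi; congr (\pi_Pn _); apply/val_inj/rowP => i.
by rewrite !phi_coords coords_scale exprMn exprAC (prim_expr_order zP) expr1n mul1r.
Qed.

(* If q is not in the orbit of X, then some class_part a f with f in the ideal of the
   orbit is not zero at q, and its r-th power is a polynomial in the x_i^r. *)
Lemma zariski_closed_coord_power X : zariski_closed X ->
  zariski_closed (coord_power r X).
Proof.
move=> cX; have <- : zeros (ideal_of (coord_power r X)) = coord_power r X.
  apply/seteqP; split=> p; last by move=> Wp m f [_]; apply.
  have [q <-] := phi_surj p => Zq; apply: contrapT => nWq.
  have : ~ orbit_union X q.
    by move=> /in_orbit_union[a [x Xx xq]]; apply: nWq; exists x; rewrite // -xq phi_actp.
  rewrite -(zeros_ideal_of (zariski_closed_orbit cX)).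
  move=> /existsNP[m /existsNP[f /not_implyP[Jf nfq]]].
  have fm : f \is m.-homog by case: Jf.
  have [a nfaq] : exists a, (class_part a f).@[coords (repr q)] != 0.
    apply: contrapT => /forallNP all0; apply: nfq; apply/(vanishes_at_repr _ fm).
    rewrite {1}(sum_class_part f) raddf_sum big1 // => a _.
    by apply/eqP/negPn/negP/all0.
  (* The r-th power of x^a h(x^r) is g(x^r) for g = x^a h^r, which has the same degree m as [f]. *)
  pose g := 'X_[mnm_rem a] * class_root a f ^+ r.
  have powg : pow g = class_part a f ^+ r.
    by rewrite class_partE exprMn /g /pow rmorphM rmorphXn /= -!/(pow _) powX mpolyXn.
  have gm : ideal_of (coord_power r X) m g.
    apply/ideal_of_orbit_pow; rewrite powg.
    have := ideal_of_orbit_class_part a Jf; rewrite exprS mulnS => Jaf.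
    by apply: gidealMr => //; apply: dhomogMn; apply: class_part_homog.
  have gh : g \is m.-homog by case: gm.
  have /(vanishes_at_phi _ gh) := Zq m g gm.
  have pgh : pow g \is (m * r)%N.-homog by rewrite pow_homog.
  move=> /(vanishes_at_repr _ pgh); rewrite powg rmorphXn /= => /eqP.
  by rewrite expf_eq0 (negPf nfaq) andbF.
exact: zariski_closed_zeros.
Qed.

Lemma irreducible_coord_power X : irreducible_variety X ->
  irreducible_variety (coord_power r X).
Proof.
move=> iX; have [cX [x Xx] _] := iX.
have pW := gprime_coord_power (irreducible_gprime iX).
have [|+ _] := gprime_zeros pW; last by rewrite zeros_ideal_of //; exact: zariski_closed_coord_power.
by apply: hp_ideal_of_neq0; exists (phi r x), x.
Qed.

(** The product of the variables outside the prime ideal is itself outside, so it is nonzero at some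
    point of X. *)
Lemma exists_generic_point X : gprime (ideal_of X) -> X !=set0 ->
  exists2 p, X p & forall i, ~ ideal_of X 1%N 'X_i -> val (repr p) 0 i != 0.
Proof.
move=> pX X0; pose I := {i : 'I_n.+1 | ~~ `[< ideal_of X 1%N 'X_i >]}.
have [i0 nX0] := notin_ideal_of_varX X0 pX.
have nX1 : ~ ideal_of X 0%N 1 by have := nX0 0%N; rewrite expr0.
pose f (i : I) : S := 'X_(val i); pose s := index_enum I.
have fm i : f i \is 1.-homog by exact: varX_homog.
have Pm := dhomog_prod_seq s fm.
have nXP : ~ ideal_of X (1 * size s)%N (\prod_(i <- s) f i).
  by move=> /(gprime_prod pX nX1 fm)[j Xj]; have /asboolP := valP j; apply.
have [p Xp nfp] : exists2 p, X p & ~ vanishes_at (\prod_(i <- s) f i) p.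
  apply: contrapT => none; apply: nXP; split=> // p Xp.
  by apply: contrapT => nfp; apply: none; exists p.
exists p => // i Xi; apply/eqP => pi0; apply: nfp.
apply/(vanishes_at_repr _ Pm); have Xi' : ~~ `[< ideal_of X 1%N 'X_i >] by apply/asboolP.
rewrite rmorph_prod (bigD1 (Sub i Xi' : I)) //= /f /= mevalXU pi0 mul0r //.
Qed.

(** The component of f that contains its leading monomial u keeps that leading monomial and stays in
    the ideal. If x^a is not zero on X, primality removes it and leaves h with leading monomial
    [mnm_div u]. Conversely, either a variable that vanishes on X divides u, or x^a h(x^r) has
    leading monomial u. *)
Lemma glead_orbit X u : gprime (ideal_of X) -> X !=set0 ->
  glead (ideal_of (orbit_union X)) u =
  ~~ ([forall i, `[< ideal_of X 1%N 'X_i >] ==> (mnm_class u i == 0)] &&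
      ~~ glead (ideal_of (coord_power r X)) (mnm_div u)).
Proof.
move=> pX X0; rewrite negb_and negbK; apply/idP/orP.
  move=> /asboolP[f [Jf f0 fu]].
  have [good|bad] := boolP [forall i, `[< ideal_of X 1%N 'X_i >] ==> (mnm_class u i == 0)]; last by left.
  right; set a := mnm_class u.
  have Jfa := ideal_of_orbit_class_part a Jf.
  have ca : (class_part a f)@_u != 0.
    by rewrite mcoeff_class_part eqxx -fu mleadc_eq0.
  have fa0 : class_part a f != 0 by apply: contraNneq ca => ->; rewrite mcoeff0.
  have mfa : mlead (class_part a f) = u.
    apply: le_anti; apply/andP; split; last by apply: msupp_le_mlead; rewrite mcoeff_msupp.
    rewrite -fu; apply: msupp_le_mlead; rewrite mcoeff_msupp.
    have := mlead_supp fa0; rewrite mcoeff_msupp mcoeff_class_part.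
    by case: ifP; rewrite ?eqxx.
  have h0 : class_root a f != 0.
    by apply: contraNneq fa0 => h0; rewrite class_partE h0 /pow comp_mpoly0 mulr0.
  have uE : u = (mnm_rem a + mlead (class_root a f) *+ r)%MM.
    rewrite -{1}mfa class_partE mleadM ?pow_neq0 // ?mleadXm ?mlead_pow //.
    by rewrite -msupp_eq0 msuppX.
  have [_ mh] := mnm_class_eq uE.
  apply/asboolP; exists (class_root a f); split=> //.
  have hm : class_root a f \is (mdeg (mnm_div u)).-homog.
    rewrite -pow_homog; apply/dhomogP => v vs.
    have /dhomogP/(_ (mnm_rem a + v)%MM) : class_part a f \is (mdeg u).-homog by case: Jfa.
    rewrite class_partE mulrC mcoeff_msupp mcoeffMX -mcoeff_msupp => /(_ vs) /=.
    by rewrite [in RHS](mnm_divn_eq u) !mdegD mdegMn => /eqP; rewrite eqn_add2l => /eqP.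
  have phm : pow (class_root a f) \is (mdeg (mnm_div u) * r)%N.-homog by rewrite pow_homog.
  apply/ideal_of_coord_power.
  have : ideal_of X (mdeg (mnm_rem a) + mdeg (mnm_div u) * r)%N ('X_[mnm_rem a] * pow (class_root a f)).
    rewrite -class_partE; apply: (ideal_ofS (@orbit_unionS X)).
    suff -> : (mdeg (mnm_rem a) + mdeg (mnm_div u) * r)%N = mdeg u by [].
    by rewrite [in RHS](mnm_divn_eq u) mdegD mdegMn.
  have Xam : ('X_[mnm_rem a] : S) \is (mdeg (mnm_rem a)).-homog by rewrite dhomogX.
  move=> /(proj2 pX)[//|//|Xa|//]; exfalso.
  have [i0 nX0] := notin_ideal_of_varX X0 pX.
  (* At a generic point x^a is nonzero, so x^a is not in the ideal of X. *)
  have [p Xp pa] : exists2 p, X p & forall i, a i != 0 -> val (repr p) 0 i != 0.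
    have [p Xp pX'] := exists_generic_point pX X0; exists p => // i ai; apply: pX'.
    by move=> Xi; have /forallP/(_ i) := good; rewrite asboolT //= (negPf ai).
  case: Xa => _ /(_ p Xp) /(vanishes_at_repr _ Xam)/eqP; rewrite mevalX.
  apply/negP/prodf_neq0 => i _; rewrite mnmE.
  have [->|/pa] := eqVneq (a i) 0; first by rewrite expr0 oner_eq0.
  by move=> pi; rewrite expf_neq0.
case=> [|/asboolP[h [Wh h0 hu]]].
  move=> /forallPn[j]; rewrite negb_imply => /andP[/asboolP Xj uj].
  have Jj : ideal_of (orbit_union X) 1%N 'X_j.
    apply/ideal_of_orbit; split=> [|a p Xp]; first exact: varX_homog.
    case: Xj => _ /(_ p Xp) /(vanishes_at_repr _ (varX_homog R j)).
    by rewrite !mevalXU => ->; rewrite mulr0.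
  have le : (U_(j) <= u)%MM.
    rewrite lep1mP; apply: contraNneq uj => uj.
    by rewrite ffunE -val_eqE /= uj mod0n.
  apply/asboolP; exists 'X_[u]; split; rewrite ?mleadXm -?msupp_eq0 ?msuppX //.
  rewrite -{2}(submK le) mpolyXD -{1}(submK le) mdegD mdeg1.
  by apply: gidealMl => //; rewrite dhomogX.
have u0 : ('X_[mnm_rem (mnm_class u)] : S) != 0 by rewrite -msupp_eq0 msuppX.
apply/asboolP; exists ('X_[mnm_rem (mnm_class u)] * pow h); split.
- rewrite {1}(mnm_divn_eq u) mdegD mdegMn; apply: gidealMl => //.
    by rewrite dhomogX.
  exact/ideal_of_orbit_pow.
- by rewrite mulf_neq0 // pow_neq0.
- by rewrite mleadM ?pow_neq0 // mleadXm mlead_pow // hu -mnm_divn_eq.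
Qed.

End CoordinatePower.

Lemma sum_hf_card (F : fieldType) n (J : nat -> set {mpoly F[n.+1]}) M : gideal J ->
  (\sum_(j < M.+1) hf J j = #|[set u : 'X_{1..n.+1 < M.+1} | ~~ glead J u]%SET|)%N.
Proof.
move=> gJ; rewrite -sum1_card.
rewrite (partition_big (fun u : 'X_{1..n.+1 < M.+1} => Ordinal (bmdeg u)) xpredT) //=.
apply: eq_bigr => j _.
pose s := [seq bmnm u | u <- enum {: 'X_{1..n.+1 < M.+1}} & mdeg (bmnm u) == j].
rewrite (hf_count (s := s) gJ).
- rewrite count_map count_filter -sum1_count big_enum_cond; apply: eq_bigl => u.
  by rewrite !inE -val_eqE.
- rewrite map_inj_uniq; first exact/filter_uniq/enum_uniq.
  by move=> u v uv; apply/eqP; rewrite bmeqP uv.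
- move=> u; apply/mapP/eqP => [[v]|uj].
    by rewrite mem_filter => /andP[/eqP vj _] ->.
  have uM : (mdeg u < M.+1)%N by rewrite uj.
  by exists (BMultinom uM) => //; rewrite mem_filter mem_enum /= uj eqxx.
Qed.

(** * Counting translates, stabilisers and fixing elements *)

Section Count.
Variables (R : realType) (n r' : nat).
Local Notation r := r'.+1.
Local Notation C := R[i].
Local Notation Pn := (projspace R n).
Local Notation S := {mpoly C[n.+1]}.
Local Notation T := {ffun 'I_n.+1 -> 'I_r}.
Local Notation G := (Ggroup R n r).
Implicit Types (X Y Z : set Pn) (a b : T).
Hint Resolve gideal_ideal_of : core.

(** The fibres of q are translates of H. It serves for the diagonal, for orbits and for restrictions
    to a set of coordinates. *)
Lemma card_fibers (V : eqType) (q : T -> V) (H : {set T}) (L : seq V) : uniq L ->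
    (forall v, v \in L -> exists a, q a = v) ->
    (forall a b, (q a == q b) = (b - a \in H)) ->
  #|[set a | q a \in L]%SET| = (size L * #|H|)%N.
Proof.
move=> + + qH; elim: L => [|v L IH] /=.
  by move=> _ _; rewrite mul0n; apply: eq_card0 => a; rewrite inE.
move=> /andP[vL uL] sL.
have -> : [set a | q a \in v :: L]%SET = ([set a | q a == v] :|: [set a | q a \in L])%SET.
  by apply/setP => a; rewrite !inE.
rewrite cardsU (_ : _ :&: _ = finset.set0); last first.
  apply/setP => a; rewrite !inE; apply/negP => /andP[/eqP->]; exact/negP.
rewrite cards0 subn0 IH //; last by move=> w wL; apply: sL; rewrite inE wL orbT.
have [a0 q0] := sL v (mem_head _ _).
suff -> : [set a | q a == v]%SET = [set a0 + h | h in H]%SET.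
  by rewrite card_imset // => x y /addrI.
apply/setP => a; rewrite inE -q0 eq_sym qH; apply/idP/imsetP => [aH|[h hH ->]].
  by exists (a - a0) => //; rewrite addrC subrK.
by rewrite addrC addKr.
Qed.

Lemma card_exponents : #|T| = (r ^ n.+1)%N.
Proof. by rewrite card_ffun !card_ord. Qed.

Definition const_exponents : {set T} := [set [ffun=> c] | c : 'I_r]%SET.

Lemma const_exponentsP a : reflect (exists c, forall i, a i = c) (a \in const_exponents).
Proof.
apply: (iffP imsetP) => [[c _ ->]|[c ac]]; first by exists c => i; rewrite ffunE.
by exists c => //; apply/ffunP => i; rewrite ffunE.
Qed.

Lemma card_const_exponents : #|const_exponents| = r.
Proof.
rewrite card_imset ?card_ord // => c d /ffunP/(_ ord0).
by rewrite !ffunE.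
Qed.

Variables (z : C) (zP : r.-primitive_root z).
Local Notation actp := (actp zP).
Local Notation acts := (acts zP).
Local Notation cls a := (\pi_G (root_exp zP a)).

Lemma cls_eq a b : (cls a == cls b) = (b - a \in const_exponents).
Proof.
apply/eqP/const_exponentsP => [/eqmodP/asboolP[[x xP] /= xE]|[c cE]].
  have [c cx] : exists c : 'I_r, x = z ^+ c.
    have /andP[_ /eqP xr] := xP.
    by have [c cx] := prim_rootP zP xr; exists c.
  exists (- c) => i.
  have ai : a i = c + b i.
    by apply: (zX_inj zP); rewrite (zXD zP) -cx; have := xE i; rewrite !ffunE.
  by rewrite !ffunE ai opprD addrCA subrr addr0.
apply/eqmodP/asboolP; exists (Sub (z ^+ (- c)%R) (zX_unity zP (- c)%R)) => i.
have e : z ^+ a i = z ^+ (- c)%R * z ^+ b i.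
  by rewrite -(zXD zP) -(cE i) !ffunE opprB subrK.
by rewrite !val_root_exp e.
Qed.

Lemma cls_surj (tau : G) : exists a, cls a = tau.
Proof.
have ex i : exists c : 'I_r, val (repr tau i) = z ^+ c.
  have /andP[_ /eqP xr] := valP (repr tau i).
  by have [c cx] := prim_rootP zP xr; exists c.
have [c cE] := choice ex; exists [ffun i => c i].
rewrite -[RHS]reprK; congr (\pi_G _); apply/ffunP => i; apply: val_inj.
by rewrite val_root_exp ffunE cE.
Qed.

Lemma ncard_Ggroup (A : set G) :
  (ncard A * r = #|[set a | `[< A (cls a) >]]%SET|)%N.
Proof.
have fA : finite_set A by apply: sub_finite_set (finite_Ggroup R n (ltn0Sn r')).
rewrite -[X in (_ * X)%N]card_const_exponents /ncard.
rewrite -(@card_fibers _ (fun a => cls a) _ (enum_fset (fset_set A))).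
- apply: eq_card => a; rewrite !inE; apply/idP/asboolP => [aA|Aa].
    have : cls a \in fset_set A by [].
    by rewrite in_fset_set // inE.
  have : cls a \in fset_set A by rewrite in_fset_set // inE.
  by [].
- exact: fset_uniq.
- by move=> tau _; exact: cls_surj.
- exact: cls_eq.
Qed.

(** Orbit-stabiliser in the group of exponents, where each element of [Stab] has r
    representatives. *)
Lemma card_orbit_sets X :
  (size (orbit_sets zP X) * (ncard (Stab r X) * r) = r ^ n.+1)%N.
Proof.
rewrite ncard_Ggroup -card_exponents -(@card_fibers _ (fun a => acts a X)).
- rewrite -cardsT; apply: eq_card => a; rewrite !inE.
  by rewrite mem_undup; apply: map_f; rewrite mem_enum.
- exact: undup_uniq.
- by move=> Z; rewrite mem_undup => /mapP[a _ ->]; exists a.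
- move=> a b; rewrite inE; apply/eqP/asboolP => [ab|H].
    by rewrite /Stab /= -/(acts _ X) addrC actsD -ab actNs.
  have e : acts (b - a) X = X := H.
  by rewrite -{1}e -actsD addrC subrK.
Qed.

Definition good X (i : 'I_n.+1) : bool := ~~ `[< ideal_of X 1%N 'X_i >].
Definition zero_off_good X : {set T} := [set a : T | [forall i, ~~ good X i ==> (a i == 0)]]%SET.
Definition zero_on_good X : {set T} := [set a : T | [forall i, good X i ==> (a i == 0)]]%SET.

Lemma card_zero_good X : (#|zero_on_good X| * #|zero_off_good X| = r ^ n.+1)%N.
Proof.
rewrite -card_exponents cardE.
rewrite -(@card_fibers _ (fun a : T => [ffun i => if good X i then 0 else a i] : T)).
- rewrite -cardsT; apply: eq_card => a; rewrite !inE mem_enum inE.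
  by apply/forallP => i; apply/implyP; rewrite ffunE => ->.
- exact: enum_uniq.
- move=> a; rewrite mem_enum inE => /forallP a0; exists a; apply/ffunP => i.
  by rewrite ffunE; case: ifP => // gi; have := a0 i; rewrite gi => /eqP.
- move=> a b; rewrite inE; apply/eqP/forallP => [/ffunP ab i|ab].
    apply/implyP => gi; have := ab i; rewrite !ffunE (negPf gi) => ->.
    by rewrite subrr.
  apply/ffunP => i; rewrite !ffunE; case: ifPn => // gi.
  by have := ab i; rewrite gi /= !ffunE subr_eq0 => /eqP.
Qed.

(** Fixing a generic point forces one common scaling factor on all coordinates that do not vanish
    identically on X; the other coordinates are zero on X. *)
Lemma actp_fix_const X a : gprime (ideal_of X) -> X !=set0 ->
  (forall p, X p -> actp a p = p) <-> (exists c, forall i, good X i -> a i = c).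
Proof.
move=> pX X0; split=> [aX|[c ac] p Xp].
  have [p Xp pg] := exists_generic_point pX X0.
  have := aX p Xp; rewrite -{1 2}[p]reprK actp_pi => /eqmodP/asboolP[l l0 lE].
  have pE i : good X i -> z ^+ a i = l.
    move=> /asboolP/pg pi; apply: (mulIf pi).
    by have := congr1 (fun w : 'rV[C]_n.+1 => w 0 i) lE; rewrite coords_scale mxE.
  have [i0 nX0] := notin_ideal_of_varX X0 pX.
  have g0 : good X i0 by apply/asboolP; exact: (nX0 1%N).
  by exists (a i0) => i gi; apply: (zX_inj zP); rewrite !pE.
rewrite -[p]reprK actp_pi; apply/eqmodP/asboolP; exists (z ^+ c).
  by rewrite expf_neq0 // (z_neq0 zP).
apply/rowP => i; rewrite coords_scale mxE; have [/ac ->//|] := boolP (good X i).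
rewrite negbK => /asboolP[_ /(_ p Xp)] /(vanishes_at_repr _ (varX_homog R i)).
by rewrite mevalXU => ->; rewrite !mulr0.
Qed.

Lemma ncard_Fix X : gprime (ideal_of X) -> X !=set0 ->
  ncard (Fix r X) = #|zero_on_good X|.
Proof.
move=> pX X0; apply/eqP; rewrite -(eqn_pmul2r (ltn0Sn r')) ncard_Ggroup; apply/eqP.
have [i0 nX0] := notin_ideal_of_varX X0 pX.
have g0 : good X i0 by apply/asboolP; exact: (nX0 1%N).
rewrite -[X in (_ = _ * X)%N]card_const_exponents [#|zero_on_good X|]cardE.
(* Modulo the diagonal a tuple is normalised to be 0 at the good index [i0]; one that is constant on
   good indices becomes 0 on all of them. *)
rewrite -(@card_fibers _ (fun a : T => [ffun i => a i - a i0] : T)).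
- apply: eq_card => a; rewrite !inE mem_enum inE.
  apply/asboolP/forallP => [/(actp_fix_const _ pX X0)[c ac] i|H].
    by apply/implyP => gi; rewrite ffunE !ac // subrr.
  apply/(actp_fix_const _ pX X0); exists (a i0) => i gi.
  by have := H i; rewrite gi ffunE subr_eq0 => /eqP.
- exact: enum_uniq.
- move=> a; rewrite mem_enum inE => /forallP a0; exists a; apply/ffunP => i.
  by rewrite ffunE; have := a0 i0; rewrite g0 => /eqP ->; rewrite subr0.
- move=> a b; apply/eqP/const_exponentsP => [/ffunP ab|[c cE]].
    exists (b i0 - a i0) => i; have := ab i; rewrite !ffunE => e.
    have -> : b i = a i - a i0 + b i0 by rewrite e subrK.
    by rewrite addrAC [a i - a i0 - a i]addrAC subrr add0r addrC.
  apply/ffunP => i; rewrite !ffunE.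
  have ab j : b j = a j + c by rewrite -(cE j) !ffunE addrC subrK.
  by rewrite !ab opprD addrACA subrr addr0.
Qed.

End Count.

(** * Comparison of the leading coefficients *)

Section Degree.
Variables (R : realType) (n r' : nat).
Local Notation r := r'.+1.
Local Notation C := R[i].
Local Notation Pn := (projspace R n).
Local Notation S := {mpoly C[n.+1]}.
Local Notation T := {ffun 'I_n.+1 -> 'I_r}.
Implicit Types (X Y Z : set Pn) (a b : T).
Hint Resolve gideal_ideal_of : core.
Variables (z : C) (zP : r.-primitive_root z).

Lemma glead_orbit_std X u : gprime (ideal_of X) -> X !=set0 ->
  ~~ glead (ideal_of (orbit_union zP X)) u =
  (mnm_class r' u \in zero_off_good r' X) && ~~ glead (ideal_of (coord_power r X)) (mnm_div r' u).
Proof.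
move=> pX X0; rewrite glead_orbit // negbK inE; congr (_ && _).
by apply: eq_forallb => i; rewrite negbK.
Qed.

Lemma mdeg_div u m : (mdeg u <= r * m)%N -> (mdeg (mnm_div (n:=n) r' u) <= m)%N.
Proof.
rewrite {1}(mnm_divn_eq r' u) mdegD mdegMn => le.
by rewrite -(leq_pmul2r (ltn0Sn r')) [(m * _)%N]mulnC (leq_trans _ le) // leq_addl.
Qed.

Lemma mdeg_rem a : (mdeg (mnm_rem a) <= r * n.+1)%N.
Proof.
rewrite mdegE; apply: (@leq_trans (\sum_(i < n.+1) r)%N).
  by apply: leq_sum => i _; rewrite mnmE ltnW.
by rewrite sum_nat_const card_ord mulnC.
Qed.

(** Division of exponents by r with remainder is injective; the default of [insubd] is never
    reached, by [mdeg_div]. *)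
Lemma cumul_orbit_le X m : gprime (ideal_of X) -> X !=set0 ->
  (\sum_(j < (r * m).+1) hf (ideal_of (orbit_union zP X)) j <=
   #|zero_off_good r' X| * \sum_(j < m.+1) hf (ideal_of (coord_power r X)) j)%N.
Proof.
move=> pX X0; rewrite !sum_hf_card // -cardsX.
pose f (u : 'X_{1..n.+1 < (r * m).+1}) : T * 'X_{1..n.+1 < m.+1} :=
  (mnm_class r' u, insubd (@bm0 n.+1 m) (mnm_div r' u)).
have fE u : bmnm (f u).2 = mnm_div r' u.
  rewrite -[LHS]/(val (insubd _ _)) val_insubd ltnS mdeg_div //.
  by rewrite -ltnS bmdeg.
have f_inj : injective f.
  move=> u v uv; apply/eqP; rewrite bmeqP; apply/eqP.
  rewrite (mnm_divn_eq r' u) (mnm_divn_eq r' v) -!fE uv.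
  by have -> : mnm_class r' u = mnm_class r' v by case: uv.
rewrite -(card_imset _ f_inj); apply/subset_leq_card/fintype.subsetP => _ /imsetP[u + ->].
by rewrite !inE glead_orbit_std // fE inE.
Qed.

(** The inverse map (a, v) to a + r v. The extra [n.+1] makes room for the degree of a, at most r (n
    + 1). *)
Lemma cumul_orbit_ge X m : gprime (ideal_of X) -> X !=set0 ->
  (#|zero_off_good r' X| * \sum_(j < m.+1) hf (ideal_of (coord_power r X)) j <=
   \sum_(j < (r * (m + n.+1)).+1) hf (ideal_of (orbit_union zP X)) j)%N.
Proof.
move=> pX X0; rewrite !sum_hf_card // -cardsX.
pose M := (r * (m + n.+1))%N.
have deg (av : T * 'X_{1..n.+1 < m.+1}) : (mdeg (mnm_rem av.1 + av.2 *+ r)%MM < M.+1)%N.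
  have vm : (mdeg av.2 <= m)%N by exact: (bmdeg av.2).
  by rewrite mdegD mdegMn ltnS /M mulnDr addnC leq_add ?mdeg_rem // [(r * m)%N]mulnC leq_mul2r vm orbT.
pose f av : 'X_{1..n.+1 < M.+1} := BMultinom (deg av).
have f_inj : injective f.
  move=> [a v] [b w] /(congr1 (@bmnm _ _)) /= e.
  have [<- vE] := mnm_class_eq (esym e); have [-> wE] := mnm_class_eq (erefl (mnm_rem b + w *+ r)%MM).
  by congr (_, _); apply/eqP; rewrite bmeqP -vE wE.
rewrite -(card_imset _ f_inj); apply/subset_leq_card/fintype.subsetP => _ /imsetP[[a v] + ->].
rewrite !inE glead_orbit_std //= inE.
by have [-> ->] := mnm_class_eq (erefl (mnm_rem a + v *+ r)%MM).
Qed.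

Lemma eventually_poly_dilate f P (c : nat) : eventually_poly f P -> (0 < c)%N ->
  eventually_poly (fun m => f (c * m)%N) (P \Po (c%:R *: 'X)).
Proof.
move=> [N HN] c0; exists N => m Nm; rewrite horner_comp hornerZ hornerX -natrM HN //.
by rewrite (leq_trans Nm) // leq_pmull.
Qed.

Lemma size_lc_dilate (P : {poly rat}) (c : nat) : (0 < c)%N ->
  size (P \Po (c%:R *: 'X)) = size P /\
  lead_coef (P \Po (c%:R *: 'X)) = lead_coef P * c%:R ^+ (size P).-1.
Proof.
move=> c0; have c0' : c%:R != 0 :> rat by rewrite pnatr_eq0 -lt0n.
have s2 : size (c%:R *: 'X : {poly rat}) = 2 by rewrite size_scale // size_polyX.
by rewrite size_comp_poly2 // lead_coef_comp ?s2 // lead_coefZ lead_coefX mulr1.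
Qed.

Lemma hp_coord_power X : irreducible_variety X ->
  size (hp (ideal_of (coord_power r X))) = size (hp (ideal_of X)) /\
  #|zero_off_good r' X|%:R * lead_coef (hp (ideal_of (coord_power r X))) =
  r%:R ^+ size (hp (ideal_of X)) * (size (orbit_sets zP X))%:R * lead_coef (hp (ideal_of X)).
Proof.
move=> iX; have pX := irreducible_gprime iX; have [cX X0 _] := iX.
have [x Xx] := X0; set W := coord_power r X.
set PX := hp (ideal_of X); set PW := hp (ideal_of W); pose PY := hp (ideal_of (orbit_union zP X)).
have PX0 : PX != 0 by apply: hp_ideal_of_neq0.
have PW0 : PW != 0 by apply: hp_ideal_of_neq0; exists (phi r x), x.
have PY0 : PY != 0 by apply: hp_ideal_of_neq0; exists x; apply: orbit_unionS.
have orbitP Z : Z \in orbit_sets zP X -> exists a, Z = acts zP a X.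
  by rewrite mem_undup => /mapP[a _ ->]; exists a.
have [| | |sY lY] := @hp_unions _ _ X (orbit_sets zP X) (undup_uniq _) X0.
- have : acts zP 0 X \in orbit_sets zP X by rewrite mem_undup; apply: map_f; rewrite mem_enum.
  by case: orbit_sets.
- move=> _ /orbitP[a ->]; split; [by exists (actp zP a x), x|exact: gprime_acts|].
  by move=> m; apply: hf_acts.
(* Translates have equal Hilbert functions, so an inclusion between their ideals is an equality. *)
- move=> Z1 Z2 /orbitP[a ->] /orbitP[b ->] ab.
  have ba : gsub (ideal_of (acts zP b X)) (ideal_of (acts zP a X)).
    by apply: gsub_hf_eq => // m; rewrite !hf_acts.
  apply/seteqP; split; apply: gsub_ideal_of_subset => //; exact: zariski_closed_acts.
rewrite -[hp _]/PY -/PX in sY lY.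
have [SY [HSY sSY lSY]] := eventually_poly_cumul (hpP (gideal_ideal_of (orbit_union zP X))) PY0.
have [SW [HSW sSW lSW]] := eventually_poly_cumul (hpP (gideal_ideal_of W)) PW0.
rewrite -/PY -/PW in sSY lSY sSW lSW.
set A := #|zero_off_good r' X|.
have A0 : A%:R != 0 :> rat.
  rewrite pnatr_eq0 -lt0n; apply: leq_ltn_trans (leq0n 0) _; rewrite lt0n.
  have := card_zero_good r' X; rewrite -/A => e; apply: contra_eqN e => /eqP ->.
  by rewrite muln0 eq_sym expn_eq0.
have HAW : eventually_poly (fun m => A * \sum_(j < m.+1) hf (ideal_of W) j)%N (A%:R *: SW).
  by have [N HN] := HSW; exists N => m Nm; rewrite hornerZ HN // natrM.
have HY := eventually_poly_dilate HSY (ltn0Sn r').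
have [sd ld] := size_lc_dilate SY (ltn0Sn r').
have [|le1 lc1] := eventually_poly_le HY HAW.
  by exists 0%N => m _; apply: cumul_orbit_le.
have [|le2 lc2] := eventually_poly_le HAW (eventually_poly_shiftD n.+1 HY).
  by exists 0%N => m _; apply: cumul_orbit_ge.
rewrite lead_coef_shift lead_coefZ size_shift size_scale // sd ld in le1 le2 lc1 lc2.
have sS : size SW = size SY by apply/eqP; rewrite eqn_leq le1 le2.
have lS : A%:R * lead_coef SW = lead_coef SY * r%:R ^+ (size SY).-1.
  by apply: le_anti; rewrite lc1 // lc2.
have sW : size PW = size PX by move: sS; rewrite sSW sSY sY => -[].
(* Cumulation divides both leading coefficients by the same size, which cancels; the dilation by r
   contributes r to the power [size PY], the degree of [SY]. *)
split=> //; rewrite -lSW mulrCA lS sW -sY -mulrA -lY -/PY -lSY sSY /=.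
by rewrite [LHS]mulrA [LHS]mulrC.
Qed.

End Degree.

(** Here q = r, t = r^(n+1), p = r^dim, d = dim!, a = r^k, f and s are the orders of [Fix] and
    [Stab], N counts the translates, and l, l' are the leading coefficients for X and its power. *)
Lemma degree_ratio (K : fieldType) (a f t N s q p l l' d : K) : q != 0 -> t != 0 ->
  a * l' = q * p * N * l -> f * a = t -> N * (s * q) = t -> d * l' = f / s * p * (d * l).
Proof.
move=> q0 t0 al fa Ns.
have a0 : a != 0 by apply: contraNneq t0 => a0; rewrite -fa a0 mulr0.
have s0 : s != 0 by apply: contraNneq t0 => s0; rewrite -Ns s0 mul0r mulr0.
apply: (mulfI a0); rewrite mulrCA al.
have -> : a * (f / s * p * (d * l)) = (f * a) / s * p * (d * l) by ring.
by rewrite fa -Ns; field.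
Qed.

Theorem theorem2p3 (R : realType) (n r : nat) (r_gt0 : (0 < r)%N)
    (X : set (projspace R n)) (X_irr : irreducible_variety X) :
  degree (coord_power r X) =
    (ncard (Fix r X))%:R / (ncard (Stab r X))%:R * r%:R ^+ krull_dim X * degree X.
Proof.
case: r r_gt0 => // r' _; set r := r'.+1.
have [z zP] := @prim_root_exists R[i] r (ltn0Sn r').
have pX := irreducible_gprime X_irr; have [_ X0 _] := X_irr.
have [sW lW] := hp_coord_power zP X_irr.
(* Equal sizes of Hilbert polynomials give equal dimensions, as the power is irreducible too; hence
   both degrees carry the same factorial. *)
have dW : krull_dim (coord_power r X) = krull_dim X.
  apply/eqP; rewrite -eqSS !krull_dim_size_hp //; first exact/eqP.
  exact: irreducible_coord_power zP _ X_irr.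
rewrite /degree dW !hilbert_poly_ideal_of.
rewrite (ncard_Fix zP pX X0).
have NS := card_orbit_sets zP X; have FA := card_zero_good r' X.
have r0 : r%:R != 0 :> rat by rewrite pnatr_eq0.
have rn0 : (r ^ n.+1)%:R != 0 :> rat by rewrite pnatr_eq0 expn_eq0.
move/(congr1 (fun k : nat => k%:R : rat)): NS; move/(congr1 (fun k : nat => k%:R : rat)): FA.
rewrite -krull_dim_size_hp // exprS in lW.
rewrite /= !natrM => FA' NS'.
exact: degree_ratio r0 rn0 lW FA' NS'.
Qed.
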